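(* Let $f:(\mathbb{C}^2,0)\to(\mathbb{C},0)$ be a holomorphic function germ, mini-regular in $x$, and let $\mathcal{C}=\mathcal{GC}(\gamma_* )$ be a gradient canyon of $f$ of degree $d=d_{\mathcal{C}}>1$. Let $E_{con}$ be the top compact edge of the augmented Newton polygon $\widehat{\mathcal{NP}}(f_x,\mathcal{C})$. Then $$\operatorname{len}_x(E_{con})=\operatorname{mult}^{\mathrm{bar}}(\mathcal{C}).$$
   Context: **Arcs.** $\mathbb{F}$ is the field of convergent fractional power series (Puiseux series) in $y$ over $\mathbb{C}$; $\operatorname{ord}$ is the order in $y$; $\mathbb{F}_1=\{\eta\in\mathbb{F}:\operatorname{ord}\eta\ge1\}$. For $\eta=\sum a_iy^{n_i/N}\in\mathbb{F}_1$ with $N$ minimal, $\eta_*$ denotes the curve germ that is the image of $t\mapsto(\eta(t^N),t^N)$; the $N$ conjugates of $\eta$ define the same $\eta_*$. A germ $f$ with $m=\operatorname{ord}_0f$ is mini-regular in $x$ if its initial form $f_m$ satisfies $f_m(1,0)\ne0$. A polar arc of $f$ is $\gamma\in\mathbb{F}_1$ with $f_x(\gamma(y),y)\equiv0$ and $f(\gamma(y),y)\not\equiv0$; put $h(\gamma)=\operatorname{ord}f(\gamma(y),y)$. **Canyons.** The gradient degree $d(\gamma)\in\mathbb{Q}$ of a polar arc $\gamma$ is the smallest $q$ such that $\operatorname{ord}\|\operatorname{grad}f(\gamma(y),y)\|=\operatorname{ord}\|\operatorname{grad}f(\gamma(y)+uy^q,y)\|$ for generic $u\in\mathbb{C}$.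 The gradient canyon $\mathcal{GC}(\gamma_* )$ is the set of curve germs $\alpha_*$ with $\alpha=\gamma+uy^{d(\gamma)}+\text{h.o.t.}$, $u\in\mathbb{C}$. All polar arcs in a canyon $\mathcal{C}$ have the same gradient degree $d_{\mathcal{C}}$ (the degree of $\mathcal{C}$) and the same order $h_{\mathcal{C}}=h(\gamma)$. **Augmented Newton polygon.** For a (possibly fractional in $Y$) series $G(X,Y)=\sum c_{ij}X^iY^j$, $\mathcal{NP}(G)$ is the boundary of the convex hull of $\{(i+u,j+v):c_{ij}\neq0,\ u,v\ge0\}$. $\mathcal{NP}(f_x,\gamma)$ is the Newton polygon of $f_x(X+\gamma(Y),Y)$, and $\widehat{\mathcal{NP}}(f_x,\gamma)=\operatorname{Conv}(\mathcal{NP}(f_x,\gamma)\cup\{(0,h(\gamma)-1)\})\subset\mathbb{R}^2$. It is the same for all polar arcs $\gamma$ with $\gamma_*\in\mathcal{C}$ and is denoted $\widehat{\mathcal{NP}}(f_x,\mathcal{C})$. Its top compact edge $E_{con}$ is the compact edge of its lower boundary with left endpoint $(0,h_{\mathcal{C}}-1)$; $\operatorname{len}_x$ is the horizontal length (the length of the projection to the $X$-axis). **Bar multiplicity.** Write $f_x=v\prod_{i=1}^{m-1}(x-\gamma_i(y))$, $v$ a unit, $\gamma_i\in\mathbb{F}_1$ the Puiseux roots of $f_x$ listed with multiplicity (conjugates are distinct indices, repeated roots are repeated). Put $I(\mathcal{C})=\{i\in\{1,\dots,m-1\}\mid\gamma_{i,*}\in\mathcal{C}\}$. For a fixed Puiseux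 representative $\gamma$ (one of the $\gamma_i$, $i\in I(\mathcal{C})$), $$\operatorname{mult}^{\mathrm{bar}}(\mathcal{C})=\#\{i\in I(\mathcal{C})\mid\operatorname{ord}(\gamma_i(y)-\gamma(y))\ge d\},\qquad\operatorname{ord}0=\infty.$$ *)

(* Defs.v *)
From HB Require Import structures.
From mathcomp Require Import all_boot all_order all_algebra complex.
From mathcomp Require Import all_classical all_reals all_analysis.
Set Implicit Arguments.
Unset Strict Implicit.
Unset Printing Implicit Defensive.
Import Order.TTheory GRing.Theory Num.Theory.
Import numFieldNormedType.Exports.
Local Open Scope classical_set_scope.
Local Open Scope ring_scope.

(* R[i]^o is the field R[i] of complex numbers with its usual topology. *)
Notation plane_germ R := (set (set (R[i]^o * R[i]^o))).

(* [g i j] is the coefficient of x^i y^j. *)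
Definition bivar (R : realType) := nat -> nat -> R[i].

(* [a q] is the coefficient of y^q.  Pointwise + and - of functions are those
   of series; pointwise products are not, use [fmul] and [fexp]. *)
Definition fracser (R : realType) := rat -> R[i].

(* [P k q] is the coefficient of X^k Y^q. *)
Definition fracserX (R : realType) := nat -> fracser R.

Section Arcs.
Variable R : realType.
Implicit Types (a b : fracser R) (N : nat).

Definition is_denom a N :=
  (0 < N)%N /\ forall q, a q != 0 -> q * N%:R \is a Num.int.

(* The values at t of the partial sums of a(t^N) (nonnegative powers of t). *)
Definition puiseux_sums a N (t : R[i]) : nat -> R[i]^o :=
  series (fun n => a (n%:R / N%:R) * t ^+ n : R[i]^o).

(* The field F: finitely many negative exponents do not affect convergence. *)
Definition is_puiseux a := exists N,
  [/\ is_denom a N,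
      exists K : rat, forall q, q < K -> a q = 0
    & \forall t \near (0 : R[i]^o), cvgn (puiseux_sums a N t)].

Definition is_lead a (q : rat) := a q != 0 /\ forall s, s < q -> a s = 0.

(* A nonzero Puiseux series has a leading exponent, so +oo is ord 0. *)
Definition ord a : \bar rat :=
  if `[< exists q, is_lead a q >] then (xget 0 [set q | is_lead a q])%:E
  else +oo%E.

Definition is_arc a := is_puiseux a /\ (1%:E <= ord a)%E.

(* The sum has finite support when a and b are Puiseux series. *)
Definition fmul a b : fracser R :=
  fun q => \sum_(s \in [set: rat]) a s * b (q - s).

Definition fone : fracser R := fun q => (q == 0)%:R.

Definition fexp a (n : nat) : fracser R := iter n (fmul a) fone.

(* u y^q *)
Definition fmono (u : R[i]) (q : rat) : fracser R :=
  fun s => if s == q then u else 0.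

Definition ramification a N :=
  is_denom a N /\ forall M, is_denom a M -> (N <= M)%N.

(* The points (a(t^N), t^N) with N minimal, for all t where a(t^N) converges;
   t is small when t^N is, so this set has the germ at 0 of the image of
   t |-> (a(t^N), t^N). *)
Definition arc_image a : set (R[i]^o * R[i]^o) :=
  [set z : R[i]^o * R[i]^o | exists N t,
     [/\ ramification a N, puiseux_sums a N t @ \oo --> z.1 & z.2 = t ^+ N]].

(* The germ at 0 of a subset of C^2, as an equivalence class of subsets. *)
Definition germ0 (A : set (R[i]^o * R[i]^o)) : plane_germ R :=
  [set B | \forall z \near ((0, 0) : R[i]^o * R[i]^o), A z <-> B z].

(* a_* *)
Definition curve a := germ0 (arc_image a).

End Arcs.

Section Germs.
Variable R : realType.
Implicit Types (f g v : bivar R) (a gamma : fracser R).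

Definition convergent g := exists2 r : R, 0 < r &
  summable [set: nat * nat]
    (fun ij => (ComplexField.Normc.normc (g ij.1 ij.2) * r ^+ (ij.1 + ij.2))%:E).

(* Holomorphic germs (C^2,0) -> (C,0), identified with their Taylor series. *)
Definition holomorphic_germ f := convergent f /\ f 0%N 0%N = 0.

Definition holomorphic_unit v := convergent v /\ v 0%N 0%N != 0.

Definition order0 f (m : nat) :=
  (exists i j, (i + j = m)%N /\ f i j != 0) /\
  (forall i j, (i + j < m)%N -> f i j = 0).

Definition homog_part f (m : nat) (x y : R[i]) : R[i] :=
  \sum_(i < m.+1) f i (m - i)%N * x ^+ i * y ^+ (m - i).

Definition mini_regular f := exists m, order0 f m /\ homog_part f m 1 0 != 0.

Definition dx g : bivar R := fun i j => g i.+1 j *+ i.+1.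
Definition dy g : bivar R := fun i j => g i j.+1 *+ j.+1.

(* The series g(X + a(Y), Y): expand the sum of the g_ij (X + a(Y))^i Y^j.
   Each coefficient is a sum of finite support as soon as ord a > 0. *)
Definition recenter g a : fracserX R := fun k q =>
  \sum_(ij \in [set: nat * nat])
     (g ij.1 ij.2 * fexp a (ij.1 - k) (q - ij.2%:R)) *+ 'C(ij.1, k).

(* g(a(y), y) *)
Definition along g a : fracser R := recenter g a 0%N.

Definition polar_arc f gamma :=
  [/\ is_arc gamma, along (dx f) gamma = 0 & along f gamma <> 0].

Definition height f gamma : \bar rat := ord (along f gamma).

(* The order of the norm of a vector of series is the least of their orders. *)
Definition grad_ord f a : \bar rat :=
  Order.min (ord (along (dx f) a)) (ord (along (dy f) a)).

(* "Generic u" means all but finitely many u. *)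
Definition grad_stable f gamma (q : rat) :=
  finite_set [set u | grad_ord f gamma <> grad_ord f (gamma + fmono u q)].

(* Only exponents q > 0 are considered: otherwise f and its derivatives cannot
   be evaluated along gamma + u y^q. *)
Definition gradient_degree f gamma (d : rat) :=
  [/\ 0 < d, grad_stable f gamma d
    & forall q, 0 < q -> grad_stable f gamma q -> d <= q].

(* The canyon of gamma_*, for d the gradient degree of gamma. *)
Definition canyon gamma (d : rat) : set (plane_germ R) :=
  [set c | exists alpha u,
     [/\ is_arc alpha, (d%:E < ord (alpha - (gamma + fmono u d))%R)%E
       & c = curve alpha]].

End Germs.

Section NewtonPolygon.
Variable R : realType.
Local Notation plane := (R^o * R^o)%type.

Definition conv_hull (A : set plane) : set plane :=
  smallest (fun K : set (convex_lmodType plane) => convex_set K) A.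

Definition boundary (A : set plane) : set plane := closure A `\` interior A.

Definition newton_polygon (G : fracserX R) : set plane :=
  boundary (conv_hull
    [set p | exists i j (u v : R),
       [/\ G i j != 0, 0 <= u, 0 <= v & p = (i%:R + u, ratr j + v)]]).

(* (0, h(gamma) - 1) *)
Definition top_vertex (f : bivar R) (gamma : fracser R) : plane :=
  (0, ratr (fine (height f gamma)) - 1).

Definition aug_newton_polygon (f : bivar R) (gamma : fracser R) : set plane :=
  conv_hull (newton_polygon (recenter (dx f) gamma)
             `|` [set top_vertex f gamma]).

Definition segment (p q : plane) : set plane :=
  [set z | exists t : R, 0 <= t <= 1 /\ z = p + t *: (q - p)].

(* E is the compact edge with left endpoint p of the lower boundary of S: a
   nondegenerate segment cut out of S by a non-vertical line supporting S from
   below. *)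
Definition lower_edge (S : set plane) (p : plane) (E : set plane) :=
  exists (q : plane) (s : R),
    [/\ p.1 < q.1, E = segment p q,
        forall z, S z -> p.2 + s * (z.1 - p.1) <= z.2
      & S `&` [set z | z.2 = p.2 + s * (z.1 - p.1)] = E].

(* E_con; the empty set if there were no such edge. *)
Definition top_edge (f : bivar R) (gamma : fracser R) : set plane :=
  xget set0 [set E | lower_edge (aug_newton_polygon f gamma)
                                (top_vertex f gamma) E].

Definition len_x (E : set plane) : R := sup (fst @` E) - inf (fst @` E).

End NewtonPolygon.

Section Factorization.
Variable R : realType.

Definition mulX (P Q : fracserX R) : fracserX R :=
  fun k => \sum_(i < k.+1) fmul (P i) (Q (k - i)%N).

Definition oneX : fracserX R := fun k => if k is 0%N then @fone R else 0.

(* X - a *)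
Definition XsubF (a : fracser R) : fracserX R :=
  fun k => match k with 0%N => - a | 1%N => @fone R | _ => 0 end.

Definition embed (g : bivar R) : fracserX R :=
  fun k q => if q \is a Num.nat then g k (Num.truncn q) else 0.

Definition factors_as (g v : bivar R) (n : nat) (r : 'I_n -> fracser R) :=
  embed g = mulX (embed v) (\big[mulX/oneX]_(i < n) XsubF (r i)).

(* mult^bar, for the canyon K of degree d, the Puiseux roots r of f_x and the
   Puiseux representative gamma. *)
Definition mult_bar (n : nat) (r : 'I_n -> fracser R)
    (K : set (plane_germ R)) (d : rat) (gamma : fracser R) : nat :=
  #|[set i | `[< K (curve (r i)) >] && (d%:E <= ord (r i - gamma)%R)%E]%SET|.

End Factorization.

(* Main.v *)
Require Import Defs.
From HB Require Import structures.
From mathcomp Require Import all_boot all_order all_algebra complex.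
From mathcomp Require Import all_classical all_reals all_analysis.
From mathcomp Require Import ring lra zify.
Import Order.TTheory GRing.Theory Num.Theory.
Import numFieldNormedType.Exports.
Set Implicit Arguments.
Unset Strict Implicit.
Unset Printing Implicit Defensive.
Local Open Scope classical_set_scope.
Local Open Scope ring_scope.

(* Weigh X by d and y by 1, and let (w, k) be the weight and the X-degree of the
   initial form of f_x(X + a(y), y).  Both are additive under products, so
   f_x = v * prod_i (x - r_i) gives w = sum_i min(d, ord(r_i - a)) and
   k = #{i | d <= ord(r_i - a)}.  Hence (w, k) depends only on a modulo y^d, and
   by equivariance it is the same for the conjugates of a: it is constant on the
   canyon, where k is mult^bar.  On the other hand the line of slope -d through
   (0, w) supports the Newton polygon of f_x(X + a(y), y) and meets it last at
   X = k, so the top edge has length k as soon as w = h - 1.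

   For w = h - 1: from d/dy f(c(y), y) = f_x c' + f_y one gets
   ord grad f(gamma) = h - 1 at a polar arc.  If w < h - 1, then
   ord f_x(gamma + u y^d) = w for generic u, so d is not stable.  If w > h - 1,
   the weight still exceeds h - 1 for some exponent q with 1 < q < d, and along
   gamma + u y^q the orders of f and of the gradient do not change, so d is not
   minimal. *)

(** * Sums with finite support and series in a lattice of exponents *)

(** A fractional series is a bare function of its exponent and [fmul] is a finite-support sum, so no
    ring laws come for free. The recentered factorization, the Taylor formula and the chain rule are
    therefore proved for polynomial truncations in X and t = y^(1/N), where they are ring
    identities, and carried back coefficient by coefficient. A canyon is a set of curve germs:
    membership of [curve a] only provides some arc with the same image that is close to [gamma0].
    That two arcs with the same image are conjugate is the analytic step, an identity theorem for
    power series in t. The edge owes its left end to the added vertex: f_x vanishes along a polar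
    arc, so its polygon has no point on the axis X = 0. The vertex (0, h - 1) falls on the
    supporting line of slope -d exactly when w = h - 1. The assumption d > 1 leaves room for an
    exponent q with 1 < q < d, for which gamma + u y^q still has order at least 1, and it puts the
    terms of f that involve a perturbation of order d too high to change the height. *)

Section FiniteSupportSums.
Variable V : nmodType.

Lemma fsum_pt (I : choiceType) (F : I -> V) (i0 : I) :
  (forall i, i != i0 -> F i = 0) -> \sum_(i \in [set: I]) F i = F i0.
Proof.
move=> F0; rewrite (fsbigE [:: i0]) ?big_mkcond ?big_seq1 ?in_setT// => i _.
by rewrite inE => /F0.
Qed.

Lemma fsum_inj_nat (I : choiceType) (F : I -> V) (h : nat -> I) n :
  injective h -> (forall i, F i != 0 -> exists2 l, (l < n)%N & i = h l) ->
  \sum_(i \in [set: I]) F i = \sum_(l < n) F (h l).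
Proof.
move=> hI hF; rewrite (fsbigE (map h (iota 0 n))).
- rewrite big_map -(big_mkord xpredT (fun l => F (h l))) /index_iota subn0.
  by apply: eq_bigl => l; rewrite in_setT.
- by rewrite map_inj_uniq ?iota_uniq.
- by [].
move=> i _ /negP iN; apply/eqP/negP => /negP /hF [l ln il]; apply: iN.
by rewrite il map_f// mem_iota.
Qed.

Lemma fsum_nat2 (F : nat * nat -> V) m n :
  (forall i j, F (i, j) != 0 -> (i < m)%N && (j < n)%N) ->
  \sum_(x \in [set: nat * nat]) F x = \sum_(i < m) \sum_(j < n) F (val i, val j).
Proof.
move=> hF; rewrite (fsbigE [seq (i, j) | i <- iota 0 m, j <- iota 0 n]).
- rewrite (eq_bigl xpredT) => [|x]; last by rewrite in_setT.
  rewrite big_allpairs.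
  rewrite -(big_mkord xpredT (fun i => \sum_(j < n) F (i, val j))).
  rewrite /index_iota subn0; apply: eq_bigr => i _.
  by rewrite -(big_mkord xpredT (fun j => F (i, j))) /index_iota subn0.
- by apply: allpairs_uniq; rewrite ?iota_uniq// => -[a b] [c e] _ _ [-> ->].
- by [].
move=> [i j] _ /negP iN; apply/eqP/negP => /negP /hF /andP[im jn]; apply: iN.
by apply/allpairsP; exists (i, j); rewrite !mem_iota.
Qed.

End FiniteSupportSums.

Section Lattice.
Variable R : realType.
Implicit Types (a b : fracser R) (N : nat).

(* A series of this form is a power series in y^(1/N). *)
Definition in_lattice N a :=
  forall q, a q != 0 -> exists n : nat, q = n%:R / N%:R.

(** What remains of [is_arc] without convergence. The bound 1 on the exponents makes the n-th power
    start at y^n or later, which keeps [recenter] a finite sum and lets substitution respect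
    truncations. *)
Definition tame N a := in_lattice N a /\ forall q, a q != 0 -> 1 <= q.

Lemma latE N (i j : nat) : (0 < N)%N -> (i%:R / N%:R == j%:R / N%:R :> rat) = (i == j).
Proof.
move=> N0; have N0' : (N%:R : rat) != 0 by rewrite pnatr_eq0 -lt0n.
by rewrite (inj_eq (mulIf (invr_neq0 N0'))) eqr_nat.
Qed.

Lemma latB N (i j : nat) : (j <= i)%N ->
  (i%:R / N%:R - j%:R / N%:R = (i - j)%N%:R / N%:R :> rat).
Proof. by move=> ji; rewrite -mulrBl natrB. Qed.

Lemma latD N (i j : nat) :
  (i%:R / N%:R + j%:R / N%:R = (i + j)%N%:R / N%:R :> rat).
Proof. by rewrite -mulrDl natrD. Qed.

Lemma lat_lt N (i j : nat) : (0 < N)%N -> (i%:R / N%:R < j%:R / N%:R :> rat) = (i < j)%N.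
Proof. by move=> N0; rewrite ltr_pM2r ?ltr_nat// invr_gt0 ltr0n. Qed.

Lemma lat_nat N (i : nat) : (0 < N)%N -> i%:R = (i * N)%N%:R / N%:R :> rat.
Proof. by move=> N0; rewrite natrM mulfK// pnatr_eq0 -lt0n. Qed.

Lemma in_lattice_ext N a q : in_lattice N a ->
  ~ (exists n : nat, q = n%:R / N%:R) -> a q = 0.
Proof. by move=> aN qN; apply/eqP/negP => /negP /aN. Qed.

Lemma in_latticeM N M a : (0 < M)%N -> in_lattice N a -> in_lattice (N * M) a.
Proof.
move=> M0 aN q /aN [n ->]; exists (n * M)%N.
by rewrite !natrM -mulf_div divff ?mulr1// pnatr_eq0 -lt0n.
Qed.

Lemma tameM N M a : (0 < M)%N -> tame N a -> tame (N * M) a.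
Proof. by move=> M0 [aN a1]; split=> //; exact: in_latticeM. Qed.

Lemma in_lattice0 N : in_lattice N (0 : fracser R).
Proof. by move=> q; rewrite eqxx. Qed.

Lemma in_latticeD N a b : in_lattice N a -> in_lattice N b -> in_lattice N (a + b).
Proof.
move=> aN bN q; rewrite fctE => ab0.
have [a0|/aN//] := eqVneq (a q) 0; apply: bN.
by move: ab0; rewrite a0 add0r.
Qed.

Lemma in_latticeN N a : in_lattice N a -> in_lattice N (- a).
Proof. by move=> aN q; rewrite fctE oppr_eq0 => /aN. Qed.

Lemma in_lattice_sum N (I : Type) (r : seq I) (P : pred I) (F : I -> fracser R) :
  (forall i, P i -> in_lattice N (F i)) -> in_lattice N (\sum_(i <- r | P i) F i).
Proof.
by move=> FN; apply: big_ind => //; [exact: in_lattice0|exact: in_latticeD].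
Qed.

Lemma tameD N a b : tame N a -> tame N b -> tame N (a + b).
Proof.
move=> [aN a1] [bN b1]; split; first exact: in_latticeD.
move=> q; rewrite fctE => ab0.
have [a0|/a1//] := eqVneq (a q) 0; apply: b1.
by move: ab0; rewrite a0 add0r.
Qed.

Lemma tameN N a : tame N a -> tame N (- a).
Proof. by move=> [aN a1]; split=> [|q]; [exact: in_latticeN|rewrite fctE oppr_eq0 => /a1]. Qed.

Lemma in_lattice_fone N : in_lattice N (@fone R).
Proof.
move=> q; rewrite /fone; have [-> _|] := eqVneq q 0; last by rewrite eqxx.
by exists 0%N; rewrite mul0r.
Qed.

Lemma fmul_nz a b q : fmul a b q != 0 -> exists s, a s != 0 /\ b (q - s) != 0.
Proof.
move=> ab; apply: contrapT => H; move/eqP: ab; apply.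
apply: fsbig1 => s _; apply/eqP/negP => /negP; rewrite mulf_eq0 negb_or => /andP[A B].
by apply: H; exists s.
Qed.

Lemma fmul_lattice N a b : in_lattice N a -> in_lattice N b -> in_lattice N (fmul a b).
Proof.
move=> aN bN q /fmul_nz [s [/aN[i ->] /bN[j e]]].
by exists (i + j)%N; rewrite -latD -e addrC subrK.
Qed.

Lemma fexp_lattice N a n : in_lattice N a -> in_lattice N (fexp a n).
Proof.
by move=> aN; elim: n => [|n IH] /=; [exact: in_lattice_fone|exact: fmul_lattice].
Qed.

Lemma fmul_coef N a b n : (0 < N)%N -> in_lattice N a -> in_lattice N b ->
  fmul a b (n%:R / N%:R) = \sum_(i < n.+1) a (i%:R / N%:R) * b ((n - i)%N%:R / N%:R).
Proof.
move=> N0 aN bN; rewrite /fmul (fsum_inj_nat (h := fun i : nat => i%:R / N%:R) (n := n.+1)).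
- by apply: eq_bigr => -[i /= /ltnSE lin] _; rewrite latB.
- by move=> i j /eqP; rewrite latE// => /eqP.
move=> s; rewrite mulf_eq0 negb_or => /andP[/aN[i ->] /bN [j /eqP e]]; exists i => //.
by move: e; rewrite subr_eq latD latE// => /eqP ->; rewrite ltnS leq_addl.
Qed.

Lemma fexp_ge a n c q : (forall s, a s != 0 -> c <= s) -> fexp a n q != 0 -> n%:R * c <= q.
Proof.
move=> a1; elim: n q => [|n IH] q /=.
  by rewrite /fexp /= /fone mul0r; have [->//|] := eqVneq q 0; rewrite eqxx.
move=> /fmul_nz [s [/a1 s1 /IH qs]]; move: qs; rewrite -natr1 mulrDl mul1r.
by lra.
Qed.

End Lattice.

(** * Polynomial truncations of series *)

Section PolyFacts.
Variable C : comNzRingType.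

Lemma coef_exp_low (p : {poly C}) n i : p`_0 = 0 -> (i < n)%N -> (p ^+ n)`_i = 0.
Proof.
move=> p0; elim: n i => [//|n IH] i il; rewrite exprS coefM big1// => -[j /= jl] _.
case: j jl => [|j] jl; first by rewrite p0 mul0r.
by rewrite IH ?mulr0//; lia.
Qed.

Lemma coef_XaddC_exp (c : C) i k : (('X + c%:P) ^+ i)`_k = c ^+ (i - k) *+ 'C(i, k).
Proof.
rewrite addrC exprDn coef_sum.
under eq_bigr => l _ do rewrite coefMn -rmorphXn mulrC coefMC coefXn.
have [ki|ik] := leqP k i; last first.
  rewrite bin_small// mulr0n big1// => -[l /= li] _.
  by rewrite (_ : k == l = false) ?mul0r ?mul0rn//; apply/eqP; lia.
rewrite (bigD1 (Ordinal (ki : (k < i.+1)%N)))//= eqxx mul1r big1 ?addr0//.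
by move=> j /eqP jk; case: eqP => [kj|]; rewrite ?mul0r ?mul0rn//; case: jk; apply/val_inj.
Qed.

Lemma coef_comp_XaddC (P : {poly C}) (p : C) L k : (size P <= L)%N ->
  (P \Po ('X + p%:P))`_k = \sum_(i < L) P`_i * p ^+ (i - k) *+ 'C(i, k).
Proof.
move=> PL; rewrite comp_polyE coef_sum.
rewrite -(big_mkord xpredT (fun i => (P`_i *: ('X + p%:P) ^+ i)`_k)).
rewrite -(big_mkord xpredT (fun i => P`_i * p ^+ (i - k) *+ 'C(i, k))).
rewrite [RHS](big_cat_nat (n := size P))//=.
have -> : \sum_(size P <= i < L) P`_i * p ^+ (i - k) *+ 'C(i, k) = 0.
  rewrite big_nat_cond big1// => i /andP[/andP[Pi _] _].
  by rewrite nth_default// mul0r mul0rn.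
rewrite addr0 !big_mkord; apply: eq_bigr => i _; rewrite coefZ coef_XaddC_exp mulrnAr.
by [].
Qed.

Lemma horner_coef_le (P : {poly C}) x L : (size P <= L)%N ->
  P.[x] = \sum_(i < L) P`_i * x ^+ i.
Proof. exact: horner_coef_wide. Qed.

End PolyFacts.

Section Representation.
Variable R : realType.
Implicit Types (a b c : fracser R) (N T : nat) (S : fracserX R) (f g : bivar R).
Implicit Types (p : {poly R[i]}) (P Q : {poly {poly R[i]}}).

(* [p] is the series [a] in t = y^(1/N), modulo t^T. *)
Definition rep N T a p := forall j, (j < T)%N -> a (j%:R / N%:R) = p`_j.

(* [P] is the series [S] in X and t = y^(1/N), modulo the ideal (X, t)^T.  This
   ideal, unlike the one of t^T, is stable by truncation in X. *)
Definition repX N T S P :=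
  forall k j, (k + j < T)%N -> S k (j%:R / N%:R) = P`_k`_j.

Lemma repE N T a : rep N T a (\poly_(j < T) a (j%:R / N%:R)).
Proof. by move=> j jT; rewrite coef_poly jT. Qed.

Lemma repXE N T S : repX N T S (\poly_(k < T) \poly_(j < T) S k (j%:R / N%:R)).
Proof.
move=> k j kjT; have kT : (k < T)%N by lia.
have jT : (j < T)%N by lia.
by rewrite coef_poly kT coef_poly jT.
Qed.

Lemma rep_row N T S P k : repX N T S P -> rep N (T - k) (S k) P`_k.
Proof. by move=> SP j jT; apply: SP; lia. Qed.

Lemma rep_le N T T' a p : (T' <= T)%N -> rep N T a p -> rep N T' a p.
Proof. by move=> TT ap j jT; apply: ap; lia. Qed.

Lemma repD N T a b p q : rep N T a p -> rep N T b q -> rep N T (a + b) (p + q).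
Proof. by move=> ap bq j jT; rewrite fctE coefD ap ?bq. Qed.

Lemma repN N T a p : rep N T a p -> rep N T (- a) (- p).
Proof. by move=> ap j jT; rewrite fctE coefN ap. Qed.

Lemma rep_sum N T (I : Type) (r : seq I) (D : pred I) (F : I -> fracser R) G :
  (forall i, D i -> rep N T (F i) (G i)) ->
  rep N T (\sum_(i <- r | D i) F i) (\sum_(i <- r | D i) G i).
Proof.
move=> FG; apply: (big_ind2 (fun a p => rep N T a p)) => //.
- by move=> j jT; rewrite coef0.
- by move=> a p b q; exact: repD.
Qed.

Lemma rep_fmul N T a b p q : (0 < N)%N -> in_lattice N a -> in_lattice N b ->
  rep N T a p -> rep N T b q -> rep N T (fmul a b) (p * q).
Proof.
move=> N0 aN bN ap bq j jT; rewrite fmul_coef// coefM; apply: eq_bigr => -[i /= ij] _.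
by rewrite ap ?bq//; lia.
Qed.

Lemma rep_fone N T : (0 < N)%N -> rep N T (@fone R) 1.
Proof.
move=> N0 j jT; rewrite coef1 /fone.
by rewrite mulf_eq0 invr_eq0 !pnatr_eq0 (gtn_eqF N0) orbF.
Qed.

Lemma rep_fexp N T a p n : (0 < N)%N -> in_lattice N a ->
  rep N T a p -> rep N T (fexp a n) (p ^+ n).
Proof.
move=> N0 aN ap; elim: n => [|n IH] /=; first exact: rep_fone.
by rewrite exprS; apply: rep_fmul => //; exact: fexp_lattice.
Qed.

Lemma rep_tame0 N T a p : (0 < T)%N -> tame N a -> rep N T a p -> p`_0 = 0.
Proof.
move=> T0 [_ a1] /(_ 0%N T0) <-; apply/eqP/negP => /negP /a1; rewrite mul0r.
by lra.
Qed.

Lemma tame_exp_lt N a n (j : nat) : (0 < N)%N -> tame N a -> (j < n)%N ->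
  fexp a n (j%:R / N%:R) = 0.
Proof.
move=> N0 [_ a1] jn; apply/eqP/negP => /negP /(fexp_ge a1).
rewrite mulr1 => nj; have : (j%:R / N%:R <= j%:R :> rat).
  by rewrite ler_pdivrMr ?ltr0n// ler_peMr// ler1n.
by move=> /(le_trans nj); rewrite ler_nat; lia.
Qed.

(** Since p has no constant term, p^n is divisible by t^n and only the coefficients of [S i] up to
    t^(j-n) matter: the n orders gained in t pay for the drop from X^i to X^(i-n). This is why the
    ideal (X, t)^T survives the substitution of X + a for X. *)
Lemma repX_mul_exp N T S P a p i n j : (0 < N)%N ->
  (forall k, in_lattice N (S k)) -> tame N a ->
  repX N T S P -> rep N T a p -> (n <= i)%N -> (i + j < T + n)%N ->
  fmul (S i) (fexp a n) (j%:R / N%:R) = (P`_i * p ^+ n)`_j.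
Proof.
move=> N0 SN aN SP ap ni ijT; rewrite fmul_coef//; last by apply: fexp_lattice; case: aN.
rewrite coefM; apply: eq_bigr => -[j1 /= j1j] _.
have T0 : (0 < T)%N by lia.
have [jn|nj] := ltnP (j - j1) n.
  by rewrite (tame_exp_lt N0 aN jn) coef_exp_low ?mulr0//; exact: rep_tame0 ap.
rewrite SP; last lia.
by congr (_ * _); apply: (rep_fexp _ N0 aN.1 ap); lia.
Qed.

Lemma fmul_exp_small N a b n s : (0 < N)%N -> in_lattice N a -> tame N b ->
  s < n%:R -> fmul a (fexp b n) s = 0.
Proof.
move=> N0 aN [_ b1] sn; apply/eqP/negP => /negP /fmul_nz [q [/aN [i ->]]].
move=> /(fexp_ge b1); rewrite mulr1.
have : 0 <= (i%:R / N%:R : rat) by rewrite divr_ge0.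
by lra.
Qed.

(** * Recentering and products of series through their truncations *)

Lemma embedE g k (j : nat) : embed g k j%:R = g k j.
Proof. by rewrite /embed natr_nat natrK. Qed.

Lemma embed_lattice N g k : (0 < N)%N -> in_lattice N (embed g k).
Proof.
move=> N0 q; rewrite /embed; case: ifP => [/natrP [n ->] _|]; last by rewrite eqxx.
by exists (n * N)%N; exact: lat_nat.
Qed.

Lemma recenter_term g a N i l k q : (0 < N)%N -> tame N a ->
  (g i l * fexp a (i - k) (q - l%:R)) *+ 'C(i, k) != 0 ->
  [/\ (k <= i)%N, (i - k)%:R <= q - l%:R & exists n : nat, q = n%:R / N%:R].
Proof.
move=> N0 [aN a1] H.
have ki : (k <= i)%N by rewrite leqNgt; apply/negP => ik; move: H; rewrite bin_small// mulr0n eqxx.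
have A0 : fexp a (i - k) (q - l%:R) != 0.
  by apply: contraNneq H => ->; rewrite mulr0 mul0rn.
split=> //.
  by have := fexp_ge a1 A0; rewrite mulr1 natrB.
have [n /eqP] := fexp_lattice aN A0; rewrite subr_eq => /eqP ->.
by exists (n + l * N)%N; rewrite (lat_nat l N0) latD.
Qed.

Lemma recenter_lattice N g a k : (0 < N)%N -> tame N a -> in_lattice N (recenter g a k).
Proof.
move=> N0 aN q qN0; apply: contrapT => H; move/eqP: qN0; apply.
apply: fsbig1 => -[i l] _ /=; apply/eqP/negP => /negP /(recenter_term N0 aN) [_ _].
exact: H.
Qed.

Lemma recenter_nat2 g a k q m n N : (0 < N)%N -> tame N a ->
  q + k%:R < m%:R -> q < n%:R ->
  recenter g a k q =
  \sum_(i < m) \sum_(l < n) (g i l * fexp a (i - k) (q - l%:R)) *+ 'C(i, k).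
Proof.
move=> N0 aN qm qn; rewrite /recenter (fsum_nat2 (m := m) (n := n))// => i l /=.
move=> /(recenter_term N0 aN) [ki ikq _].
have l0 : 0 <= (l%:R : rat) by [].
have i0 : 0 <= ((i - k)%:R : rat) by [].
move: (ikq); rewrite natrB// => ikq'.
have k0 : 0 <= (k%:R : rat) by [].
by rewrite -!(ltr_nat rat); apply/andP; split; lra.
Qed.

Lemma recenter_fmul g a k q L N : (0 < N)%N -> tame N a -> q + k%:R < L%:R ->
  recenter g a k q = \sum_(i < L) fmul (embed g i) (fexp a (i - k)) q *+ 'C(i, k).
Proof.
move=> N0 aN qL; have qL' : q < L%:R.
  by apply: le_lt_trans qL; rewrite lerDl.
rewrite (recenter_nat2 g N0 aN qL qL'); apply: eq_bigr => -[i /= iL] _.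
rewrite sumrMnl; have [ik|ki] := ltnP i k; first by rewrite bin_small// !mulr0n.
congr (_ *+ _).
rewrite /fmul (fsum_inj_nat (h := fun l : nat => l%:R) (n := L)).
- by apply: eq_bigr => l _; rewrite embedE.
- by move=> l l' /eqP; rewrite eqr_nat => /eqP.
move=> s; rewrite mulf_eq0 negb_or => /andP[].
rewrite {1}/embed; case: ifP => [/natrP [l ->] _ H|]; last by rewrite eqxx.
exists l => //; rewrite -(ltr_nat rat); have := fexp_ge aN.2 H; rewrite mulr1.
have : 0 <= ((i - k)%:R : rat) by [].
have k0 : 0 <= (k%:R : rat) by [].
lra.
Qed.

Lemma repX_recenter N T g P a p : (0 < N)%N -> tame N a ->
  repX N T (embed g) P -> rep N T a p ->
  repX N T (recenter g a) (P \Po ('X + p%:P)).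
Proof.
move=> N0 aN gP ap k j kjT.
set L := maxn T (size P).
rewrite (coef_comp_XaddC _ (L := L)) ?leq_maxr// (recenter_fmul _ (N := N) (L := L))//; last first.
  have : (j%:R / N%:R <= j%:R :> rat).
    by rewrite ler_pdivrMr ?ltr0n// ler_peMr// ler1n.
  have : ((k + j)%:R < L%:R :> rat) by rewrite ltr_nat; rewrite /L; lia.
  by rewrite natrD; lra.
rewrite coef_sum; apply: eq_bigr => -[i /= iL] _; rewrite coefMn.
have [ik|ki] := ltnP i k; first by rewrite bin_small// !mulr0n.
congr (_ *+ _); apply: (repX_mul_exp N0 _ aN gP ap); [|lia|lia].
by move=> i'; exact: embed_lattice.
Qed.

Lemma mulX_lattice N S S' : (0 < N)%N -> (forall k, in_lattice N (S k)) ->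
  (forall k, in_lattice N (S' k)) -> forall k, in_lattice N (mulX S S' k).
Proof.
by move=> N0 SN SN' k; apply: in_lattice_sum => i _; exact: fmul_lattice.
Qed.

Lemma repX_mul N T S S' P P' : (0 < N)%N -> (forall k, in_lattice N (S k)) ->
  (forall k, in_lattice N (S' k)) -> repX N T S P -> repX N T S' P' ->
  repX N T (mulX S S') (P * P').
Proof.
move=> N0 SN SN' SP SP' k j kjT.
suff : rep N (T - k) (mulX S S' k) (P * P')`_k by apply; lia.
rewrite coefM; apply: rep_sum => -[i /= ik] _; apply: rep_fmul => //.
- by apply: rep_le (rep_row SP); lia.
- by apply: rep_le (rep_row SP'); lia.
Qed.

Lemma XsubF_lattice N a : in_lattice N a -> forall k, in_lattice N (XsubF a k).
Proof.
move=> aN [|[|k]] /=; [exact: in_latticeN|exact: in_lattice_fone|exact: in_lattice0].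
Qed.

Lemma repX_XsubF N T a p : (0 < N)%N -> rep N T a p -> repX N T (XsubF a) ('X - p%:P).
Proof.
move=> N0 ap k j kjT; rewrite coefB coefX coefC.
case: k kjT => [|[|k]] kjT /=.
- by rewrite sub0r; apply: (repN ap); lia.
- by rewrite subr0 (rep_fone (T := T) N0)//; lia.
- by rewrite subr0 coef0.
Qed.

Lemma oneX_lattice N k : in_lattice N (@oneX R k).
Proof. by case: k => [|k]; [exact: in_lattice_fone|exact: in_lattice0]. Qed.

Lemma repX_one N T : (0 < N)%N -> repX N T (@oneX R) 1.
Proof.
move=> N0 [|k] j kjT; rewrite coefC/=; last by rewrite coef0.
by rewrite (rep_fone (T := T) N0)//; lia.
Qed.

Lemma bigmulX_lattice N (I : Type) (r : seq I) (F : I -> fracserX R) : (0 < N)%N ->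
  (forall i k, in_lattice N (F i k)) ->
  forall k, in_lattice N ((\big[@mulX R/@oneX R]_(i <- r) F i) k).
Proof.
move=> N0 FN; apply: (big_ind (fun S : fracserX R => forall k, in_lattice N (S k))) => //.
- exact: oneX_lattice.
- by move=> S S' SN SN'; exact: mulX_lattice.
Qed.

Lemma repX_big N T (I : Type) (r : seq I) (F : I -> fracserX R) G : (0 < N)%N ->
  (forall i k, in_lattice N (F i k)) -> (forall i, repX N T (F i) (G i)) ->
  repX N T (\big[@mulX R/@oneX R]_(i <- r) F i) (\prod_(i <- r) G i).
Proof.
move=> N0 FN FG; elim: r => [|i r IH]; first by rewrite !big_nil; exact: repX_one.
by rewrite !big_cons; apply: repX_mul => //; exact: bigmulX_lattice.
Qed.

Lemma repX_inj N S S' : (0 < N)%N -> (forall k, in_lattice N (S k)) ->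
  (forall k, in_lattice N (S' k)) ->
  (forall T, exists2 P, repX N T S P & repX N T S' P) -> S = S'.
Proof.
move=> N0 SN SN' H; apply/funext => k; apply/funext => q.
have [[j ->]|qN] := pselect (exists j : nat, q = j%:R / N%:R).
  by have [P SP SP'] := H (k + j).+1; rewrite SP// SP'.
by rewrite !(in_lattice_ext _ qN).
Qed.

(** Composition with X + p is a ring morphism of polynomials that sends X - r_i to X - (r_i - p), so
    the factorization survives recentering in truncations of every order, and these determine the
    series. *)
Lemma recenter_factor N (g v : bivar R) n (r : 'I_n -> fracser R) a :
  (0 < N)%N -> tame N a -> (forall i, tame N (r i)) -> factors_as g v r ->
  recenter g a = mulX (recenter v a) (\big[@mulX R/@oneX R]_(i < n) XsubF (r i - a)).
Proof.
move=> N0 aN rN hfac; apply: (repX_inj N0).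
- by move=> k; exact: recenter_lattice.
- apply: mulX_lattice => // k; first exact: recenter_lattice.
  apply: bigmulX_lattice => // i k'; apply: XsubF_lattice.
  by apply: in_latticeD; [case: (rN i)|apply: in_latticeN; case: aN].
move=> T; set p := \poly_(j < T) a (j%:R / N%:R).
set V := \poly_(k < T) \poly_(j < T) embed v k (j%:R / N%:R).
pose pr i := \poly_(j < T) r i (j%:R / N%:R).
have ap : rep N T a p by exact: repE.
exists ((V * \prod_(i < n) ('X - (pr i)%:P)) \Po ('X + p%:P)).
  apply: repX_recenter => //; rewrite hfac; apply: repX_mul => //.
  - by move=> k; exact: embed_lattice.
  - by apply: bigmulX_lattice => // i k; apply: XsubF_lattice; case: (rN i).
  - exact: repXE.
  - apply: repX_big => // [i k|i]; first by apply: XsubF_lattice; case: (rN i).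
    by apply: repX_XsubF => //; exact: repE.
rewrite rmorphM rmorph_prod; apply: repX_mul => //.
- by move=> k; exact: recenter_lattice.
- apply: bigmulX_lattice => // i k'; apply: XsubF_lattice.
  by apply: in_latticeD; [case: (rN i)|apply: in_latticeN; case: aN].
- by apply: repX_recenter => //; exact: repXE.
apply: repX_big => // [i k|i].
  apply: XsubF_lattice.
  by apply: in_latticeD; [case: (rN i)|apply: in_latticeN; case: aN].
rewrite rmorphB /= comp_polyX comp_polyC.
have -> : 'X + p%:P - (pr i)%:P = 'X - (pr i - p)%:P :> {poly {poly R[i]}}.
  by rewrite polyCB opprB addrA.
by apply: repX_XsubF => //; apply: repD; [exact: repE|exact: repN].
Qed.

(** With Q = P(X + p), both sides come from P(p + e) = Q(e). The cutoff at L is harmless because b^k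
    starts at y^k or later. *)
Lemma along_taylor N g a b s L : (0 < N)%N -> tame N a -> tame N b -> s < L%:R ->
  along g (a + b) s = \sum_(k < L) fmul (recenter g a k) (fexp b k) s.
Proof.
move=> N0 aN bN sL.
have [[j sE]|sN] := pselect (exists j : nat, s = j%:R / N%:R); last first.
  rewrite (in_lattice_ext (N := N) _ sN) ?big1//.
    move=> k _; rewrite (in_lattice_ext (N := N) _ sN)//; apply: fmul_lattice.
      exact: recenter_lattice.
    by apply: fexp_lattice; case: bN.
  by apply: recenter_lattice => //; exact: tameD.
set T := (maxn j.+1 L); set p := \poly_(j < T) a (j%:R / N%:R).
set e := \poly_(j < T) b (j%:R / N%:R).
have ap : rep N T a p by exact: repE.
have be : rep N T b e by exact: repE.
set P := \poly_(k < T) \poly_(j < T) embed g k (j%:R / N%:R).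
have gP : repX N T (embed g) P by exact: repXE.
have gQ := repX_recenter N0 aN gP ap.
set Q := P \Po _ in gQ.
rewrite /along sE (repX_recenter N0 (tameD aN bN) gP (repD ap be))//=; last by rewrite /T; lia.
have -> : (P \Po ('X + (p + e)%:P))`_0 = Q.[e].
  by rewrite -horner_coef0 !horner_comp !hornerD !hornerX !hornerC add0r addrC.
set M := maxn T (size Q).
rewrite (horner_coef_le _ (L := M)) ?leq_maxr// coef_sum.
have jT : (j < T)%N by rewrite /T; lia.
rewrite -(big_mkord xpredT (fun k => (Q`_k * e ^+ k)`_j)).
rewrite -(big_mkord xpredT (fun k => fmul (recenter g a k) (fexp b k) (j%:R / N%:R))).
rewrite [LHS](big_cat_nat (n := L))//=; last by rewrite /M /T; lia.
(* Two ranges: for k < T the truncated term is a true coefficient, zero because s < k; for k >= T it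
   is zero because e^k is divisible by t^k and j < T. *)
have -> : \sum_(L <= k < M) (Q`_k * e ^+ k)`_j = 0; last first.
  rewrite addr0; apply: eq_big_nat => k /andP[_ kL].
  rewrite (repX_mul_exp N0 _ bN gQ be)//; last lia.
  by move=> k'; exact: recenter_lattice.
rewrite big_nat_cond big1// => k /andP[/andP[Lk _] _].
have [kT|Tk] := ltnP k T.
  rewrite -(repX_mul_exp N0 _ bN gQ be)//; last 2 first.
  - by move=> k'; exact: recenter_lattice.
  - by lia.
  rewrite -sE; apply: (fmul_exp_small N0) => //; first exact: recenter_lattice.
  by apply: lt_le_trans sL _; rewrite ler_nat.
rewrite coefM big1// => -[j1 /= j1j] _; rewrite coef_exp_low ?mulr0//; last lia.
by apply: (rep_tame0 _ bN be); lia.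
Qed.

(** Differentiation in X maps (X, t)^(T+1) into (X, t)^T, hence the loss of one order. *)
Lemma repX_dx N T f P : repX N T.+1 (embed f) P -> repX N T (embed (dx f)) P^`().
Proof.
move=> fP k j kjT; rewrite coef_deriv coefMn -fP; last lia.
by rewrite /embed /dx; case: ifP => // _; rewrite mul0rn.
Qed.

Lemma recenter_dx N f a k q : (0 < N)%N -> tame N a ->
  recenter f a k.+1 q *+ k.+1 = recenter (dx f) a k q.
Proof.
move=> N0 aN.
have [[j ->]|qN] := pselect (exists j : nat, q = j%:R / N%:R); last first.
  by rewrite !(in_lattice_ext (N := N) _ qN) ?mul0rn//; exact: recenter_lattice.
set T := (k + j).+1; set p := \poly_(l < T.+1) a (l%:R / N%:R).
have ap : rep N T.+1 a p by exact: repE.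
set P := \poly_(i < T.+1) \poly_(l < T.+1) embed f i (l%:R / N%:R).
have fP : repX N T.+1 (embed f) P by exact: repXE.
rewrite (repX_recenter N0 aN fP ap); last by rewrite /T; lia.
rewrite (repX_recenter N0 aN (repX_dx fP) (rep_le (leqnSn _) ap)); last by rewrite /T; lia.
rewrite -coefMn -coef_deriv deriv_comp derivD derivX derivC addr0 mulr1.
by [].
Qed.

(* y d/dy *)
Definition yder a : fracser R := fun q => ratr q * a q.

Lemma yder_lattice N a : in_lattice N a -> in_lattice N (yder a).
Proof. by move=> aN q; rewrite /yder mulf_eq0 negb_or => /andP[_ /aN]. Qed.

(** In t = y^(1/N), the operator y d/dy is t d/dt divided by N. Unlike d/dy it shifts no exponent,
    so it keeps the truncation order. *)
Definition tder N p : {poly R[i]} := N%:R^-1 *: ('X * p^`()).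

Lemma coef_tder N p j : (tder N p)`_j = j%:R / N%:R * p`_j.
Proof.
rewrite coefZ coefXM coef_deriv; case: j => [|j]; first by rewrite /= mulr0 mul0r mul0r.
by rewrite /= -[p`_j.+1 *+ _]mulr_natl mulrA [_^-1 * _]mulrC.
Qed.

Lemma rep_tder N T a p : rep N T a p -> rep N T (yder a) (tder N p).
Proof.
by move=> ap j jT; rewrite coef_tder /yder ap// fmorph_div /= !ratr_nat.
Qed.

Lemma tderM N p q : tder N (p * q) = tder N p * q + p * tder N q.
Proof.
rewrite /tder derivM mulrDr scalerDr -!scalerAl mulrA; congr (_ + _).
by rewrite mulrCA scalerAr.
Qed.

Lemma tder_exp N p n : tder N (p ^+ n) = p ^+ n.-1 *+ n * tder N p.
Proof.
rewrite /tder deriv_exp -scalerAr; congr (_ *: _).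
by rewrite [RHS]mulrC -mulrA [in RHS]mulrnAr.
Qed.

Lemma tder_sum N (I : Type) (r : seq I) (F : I -> {poly R[i]}) :
  tder N (\sum_(i <- r) F i) = \sum_(i <- r) tder N (F i).
Proof. by rewrite /tder raddf_sum mulr_sumr scaler_sumr. Qed.

Lemma tder_horner N P p : tder N P.[p] =
  P^`().[p] * tder N p + (\poly_(i < size P) tder N P`_i).[p].
Proof.
rewrite (horner_coef_le p (size_poly (size P) (fun i => tder N P`_i))) (horner_coef P).
have -> : P^`().[p] = \sum_(i < size P) P`_i * (p ^+ i.-1 *+ i).
  rewrite (horner_coef_le (P := P^`()) _ (L := size P)); last first.
    by have [->|/lt_size_deriv/ltnW//] := eqVneq P 0; rewrite deriv0.
  case E : (size P) => [|n]; first by rewrite !big_ord0.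
  rewrite big_ord_recr big_ord_recl /= mulr0n mulr0 add0r coef_deriv.
  rewrite [P`_n.+1]nth_default ?E// mul0rn mul0r addr0.
  by apply: eq_bigr => i _; rewrite coef_deriv mulrnAl mulrnAr.
rewrite tder_sum mulr_suml -big_split/=; apply: eq_bigr => -[i /= il] _.
by rewrite coef_poly il tderM tder_exp addrC !mulrA.
Qed.

Lemma along_dy N f c s : (0 < N)%N -> tame N c ->
  along ((fun i j => f i j *+ j) : bivar R) c s = along (dy f) c (s - 1).
Proof.
move=> N0 cN; set L := Num.bound `|s|.
have sL : s < L%:R by apply: le_lt_trans (ler_norm _) (archi_boundP _).
have sL1 : s < L.+1%:R by rewrite -natr1; lra.
rewrite /along (recenter_nat2 (m := L.+1) (n := L.+1) _ N0 cN) ?addr0//.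
rewrite (recenter_nat2 (m := L.+1) (n := L) _ N0 cN); [|lra|lra].
apply: eq_bigr => i _; rewrite big_ord_recl /= mulr0n mul0r mul0rn add0r.
apply: eq_bigr => l _; rewrite /dy /bump /= !add1n -natr1.
by rewrite opprD addrA [s - 1 - _]addrAC.
Qed.

(** This is the coefficient of y^s in y d/dy f(c, y) = f_x (y c') + y f_y; the factor y in front of
    f_y accounts for the shift to s - 1. *)
Lemma chain_rule N f c s : (0 < N)%N -> tame N c ->
  along (dy f) c (s - 1) =
  ratr s * along f c s - fmul (along (dx f) c) (yder c) s.
Proof.
move=> N0 cN; have yN := yder_lattice cN.1.
rewrite -(along_dy _ _ N0 cN).
have [[j ->]|sN] := pselect (exists j : nat, s = j%:R / N%:R); last first.
  have latX g : in_lattice N (along g c) by exact: recenter_lattice.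
  rewrite !(in_lattice_ext (latX _) sN) mulr0 sub0r.
  by rewrite (in_lattice_ext _ sN) ?oppr0//; exact: fmul_lattice.
set T := j.+1; set p := \poly_(l < T.+1) c (l%:R / N%:R).
have cp : rep N T.+1 c p by exact: repE.
have cp' := rep_le (leqnSn T) cp.
set P := \poly_(i < T.+1) \poly_(l < T.+1) embed f i (l%:R / N%:R).
have fP : repX N T.+1 (embed f) P by exact: repXE.
have alongP g Q : repX N T (embed g) Q -> rep N T (along g c) Q.[p].
  move=> gQ l lT; rewrite /along (repX_recenter N0 cN gQ cp')//.
  by rewrite -horner_coef0 !horner_comp !hornerD !hornerX !hornerC add0r.
have fE : repX N T (embed ((fun i j => f i j *+ j) : bivar R))
    (\poly_(i < size P) tder N P`_i).
  move=> k l klT; rewrite coef_poly.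
  have -> : (if (k < size P)%N then tder N P`_k else 0) = tder N P`_k.
    case: ltnP => // Pk; rewrite [P`_k]nth_default//.
    by rewrite /tder deriv0 mulr0 scaler0.
  rewrite coef_tder -fP; last lia.
  rewrite /embed; case: ifP => [/natrP [n e]|]; last by rewrite mulr0.
  have e' : l%:R / N%:R = n%:R :> R[i].
    by have := congr1 (@ratr R[i]) e; rewrite fmorph_div /= !ratr_nat.
  by rewrite e e' natrK mulr_natl.
rewrite (alongP _ _ fE)// (rep_fmul N0 _ yN (alongP _ _ (repX_dx fP)) (rep_tder cp'))//; last first.
  exact: recenter_lattice.
rewrite -[ratr _ * _]/(yder (along f c) (j%:R / N%:R)).
have fP' : repX N T (embed f) P by move=> k l klT; apply: fP; lia.
rewrite (rep_tder (alongP _ _ fP'))//.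
by rewrite tder_horner coefD addrC addKr.
Qed.

End Representation.

(** * Orders and initial forms *)

Section Orders.
Variable R : realType.
Implicit Types (a b c : fracser R) (N : nat) (q s : rat).

Lemma is_lead_uniq a q s : is_lead a q -> is_lead a s -> q = s.
Proof.
move=> [aq qm] [as_ sm]; apply/eqP; case: ltgtP => // [/sm|/qm] /eqP; apply: contraTT => _ //.
Qed.

Lemma ord_lead a q : is_lead a q -> ord a = q%:E.
Proof.
move=> aq; rewrite /ord asboolT; last by exists q.
by congr (_%:E); apply: xget_unique => // s /is_lead_uniq; exact.
Qed.

Lemma ord0_oo a : (forall q, a q = 0) -> ord a = +oo%E.
Proof.
by move=> a0; rewrite /ord asboolF// => -[q [+ _]]; rewrite a0 eqxx.
Qed.

Lemma lead_exists N a q : (0 < N)%N -> in_lattice N a -> a q != 0 ->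
  exists s, is_lead a s.
Proof.
move=> N0 aN aq; have [n qE] := aN _ aq.
have ex : exists n : nat, a (n%:R / N%:R) != 0 by exists n; rewrite -qE.
case: (ex_minnP ex) => m am mm; exists (m%:R / N%:R); split=> // s sm.
apply/eqP/negP => /negP as0; have [j sE] := aN _ as0.
by move: sm as0; rewrite sE lat_lt// => jm /mm; lia.
Qed.

Lemma ord_ge N a q : (0 < N)%N -> in_lattice N a ->
  (q%:E <= ord a)%E <-> (forall s, s < q -> a s = 0).
Proof.
move=> N0 aN; have [[s as0]|na] := pselect (exists s, a s != 0).
  have [e ae] := lead_exists N0 aN as0; rewrite (ord_lead ae) lee_fin; split.
    by move=> qe t tq; apply: ae.2; exact: lt_le_trans tq qe.
  by move=> H; rewrite leNgt; apply/negP => /H /eqP; rewrite (negPf ae.1).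
have a0 s : a s = 0 by apply/eqP/negP => /negP ?; apply: na; exists s.
by rewrite ord0_oo// leey; split.
Qed.

Lemma ord_gt N a q : (0 < N)%N -> in_lattice N a ->
  (q%:E < ord a)%E <-> (forall s, s <= q -> a s = 0).
Proof.
move=> N0 aN; have [[s as0]|na] := pselect (exists s, a s != 0).
  have [e ae] := lead_exists N0 aN as0; rewrite (ord_lead ae) lte_fin; split.
    by move=> qe t tq; apply: ae.2; exact: le_lt_trans tq qe.
  by move=> H; rewrite ltNge; apply/negP => /H /eqP; rewrite (negPf ae.1).
have a0 s : a s = 0 by apply/eqP/negP => /negP ?; apply: na; exists s.
by rewrite ord0_oo// ltey; split.
Qed.

Lemma ord_le_nz N a q : a q != 0 -> (0 < N)%N -> in_lattice N a -> (ord a <= q%:E)%E.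
Proof.
move=> aq N0 aN; rewrite leNgt; apply/negP => /(ord_gt _ N0 aN) /(_ q (lexx _)) /eqP.
by rewrite (negPf aq).
Qed.

Lemma arc_tame a : is_arc a -> exists2 N, (0 < N)%N & tame N a.
Proof.
move=> [[N [[N0 aN] [K aK] _]] a1]; exists N => //.
have a1' q : a q != 0 -> 1 <= q.
  (* Negative exponents are not excluded a priori. Multiplying by y^M makes all exponents
     nonnegative, so that a leading one exists; only then does the bound on [ord] say something
     about the support. *)
  move=> aq; pose M := Num.bound `|K|; pose b : fracser R := fun s => a (s - M%:R).
  have MK : 0 <= M%:R + K.
    have : `|K| < M%:R by exact: archi_boundP.
    by have := ler_norm (- K); rewrite normrN; lra.
  have bN : in_lattice N b.
    move=> s bs; have sK : K <= s - M%:R.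
      by rewrite leNgt; apply/negP => /aK /eqP; rewrite (negPf bs).
    have s0 : 0 <= s by lra.
    have : s * N%:R \is a Num.int.
      rewrite (_ : s * N%:R = (s - M%:R) * N%:R + (M * N)%N%:R); last by rewrite natrM; ring.
      by rewrite rpredD ?aN// intr_nat.
    rewrite intrEge0 ?mulr_ge0// => /natrP [n sn]; exists n.
    by rewrite -sn mulfK// pnatr_eq0 -lt0n.
  have bq : b (q + M%:R) != 0 by rewrite /b addrK.
  have [e [be em]] := lead_exists N0 bN bq.
  have ae : is_lead a (e - M%:R).
    split=> // s sm; have := em (s + M%:R); rewrite /b addrK; apply; lra.
  move: a1; rewrite (ord_lead ae) lee_fin => e1; apply: le_trans e1 _.
  by rewrite leNgt; apply/negP => /ae.2 /eqP; rewrite (negPf aq).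
split=> // q aq; have := a1' q aq; have := aN q aq => qN q1.
have : q * N%:R \is a Num.nat by rewrite natrEint qN mulr_ge0//; lra.
move=> /natrP [n qn]; exists n.
by rewrite -qn mulfK// pnatr_eq0 -lt0n.
Qed.

Lemma rat_lattice q : 0 <= q -> exists2 D, (0 < D)%N & exists n : nat, q = n%:R / D%:R.
Proof.
move=> q0; exists `|denq q|%N; first by rewrite absz_gt0 denq_neq0.
exists `|numq q|%N; rewrite !natr_absz !ger0_norm ?ler0z ?numq_ge0// ?ltW//.
by rewrite divq_num_den.
Qed.

End Orders.

Section WeightedDegree.
Variable R : realType.
Implicit Types (a b : fracser R) (P Q : fracserX R) (d w q s : rat).

(* Give X the weight d and y the weight 1: the initial form of P has weight w
   and degree k in X. *)
Definition wdeg d P w k :=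
  P k (w - k%:R * d) != 0 /\
  forall i s, P i s != 0 -> w < s + i%:R * d \/ s + i%:R * d = w /\ (i <= k)%N.

Lemma wdeg_ge d P w k i s : wdeg d P w k -> P i s != 0 -> w <= s + i%:R * d.
Proof. by move=> [_ H] /H [/ltW//|[-> _]]. Qed.

Lemma wdeg_uniq d P w k w' k' : wdeg d P w k -> wdeg d P w' k' -> w = w' /\ k = k'.
Proof.
move=> PW PW'; have := wdeg_ge PW PW'.1; have := wdeg_ge PW' PW.1; rewrite !subrK => A B.
have E : w = w' by apply/eqP; rewrite eq_le A B.
split=> //; subst w'.
have /= := PW.2 _ _ PW'.1; have /= := PW'.2 _ _ PW.1; rewrite !subrK ltxx.
by move=> -[//|[_ C]] [//|[_ D]]; apply/eqP; rewrite eqn_leq C D.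
Qed.

Lemma mulXE P Q n q : mulX P Q n q = \sum_(i < n.+1) fmul (P i) (Q (n - i)%N) q.
Proof. by rewrite /mulX fct_sumE. Qed.

(** Among the terms of least weight of the product, the one of highest X-degree arises from a single
    pair of terms, so it cannot cancel. *)
Lemma wdeg_mul d P Q w w' k k' : wdeg d P w k -> wdeg d Q w' k' ->
  wdeg d (mulX P Q) (w + w') (k + k').
Proof.
move=> PW QW.
have ltD n i s q : (i <= n)%N -> P i s != 0 -> Q (n - i)%N (q - s) != 0 ->
    [/\ w <= s + i%:R * d, w' <= (q - s) + (n%:R - i%:R) * d &
     q + n%:R * d = w + w' ->
     [/\ s + i%:R * d = w, (i <= k)%N & (n - i <= k')%N]].
  move=> ni Ps Qs; have A := wdeg_ge PW Ps; have := wdeg_ge QW Qs; rewrite natrB// => B.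
  split=> // E.
  have Es : s + i%:R * d = w by nra.
  have Eq : q - s + (n%:R - i%:R) * d = w' by nra.
  case: (PW.2 _ _ Ps) => [|[_ ->]]; first by rewrite Es ltxx.
  case: (QW.2 _ _ Qs) => [|[_ ->]]; first by rewrite natrB// Eq ltxx.
  by [].
split=> [|n q].
  set q := w + w' - _; have E : q + (k + k')%:R * d = w + w' by rewrite subrK.
  have kk : (k < (k + k').+1)%N by lia.
  rewrite mulXE (bigD1 (Ordinal kk))//= big1 ?addr0; last first.
    move=> -[i /= ik] /eqP ne; apply/eqP/negP => /negP /fmul_nz [s [Ps Qs]].
    have [_ _ /(_ E) [_ A B]] := ltD _ _ _ _ (ltnSE ik) Ps Qs.
    by apply: ne; apply: val_inj => /=; lia.
  rewrite /fmul (fsum_pt (i0 := w - k%:R * d)).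
    rewrite addKn mulf_neq0 ?PW.1// (_ : q - _ = w' - k'%:R * d) ?QW.1//.
    by rewrite /q natrD; ring.
  move=> s /eqP ne; apply/eqP/negP => /negP; rewrite mulf_eq0 negb_or => /andP[Ps Qs].
  have [_ _ /(_ E) [A _ _]] := ltD _ _ _ _ (leq_addr k' k) Ps Qs.
  by apply: ne; rewrite -A addrK.
rewrite mulXE => H.
have [i Hi] : exists i : 'I_n.+1, fmul (P i) (Q (n - i)%N) q != 0.
  apply: contrapT => Hn; move/eqP: H; apply; apply: big1 => i _.
  by apply/eqP/negP => /negP ?; apply: Hn; exists i.
have [s [Ps Qs]] := fmul_nz Hi.
have [A B C] := ltD _ _ _ _ (ltnSE (ltn_ord i)) Ps Qs.
have : w + w' <= q + n%:R * d by nra.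
rewrite le_eqVlt => /orP[/eqP e|]; last by left.
by right; split=> //; have [_] := C (esym e); lia.
Qed.

Lemma wdeg_oneX d : wdeg d (@oneX R) 0 0.
Proof.
split; first by rewrite /oneX mul0r subr0 /fone eqxx oner_neq0.
move=> [|i] s /=; last by rewrite eqxx.
rewrite /fone; have [->|] := eqVneq s 0; last by rewrite eqxx.
by right; rewrite mul0r addr0.
Qed.

Lemma wdeg_big d n (P : 'I_n -> fracserX R) (w : 'I_n -> rat) (k : 'I_n -> nat) :
  (forall i, wdeg d (P i) (w i) (k i)) ->
  wdeg d (\big[@mulX R/@oneX R]_(i < n) P i) (\sum_(i < n) w i) (\sum_(i < n) k i)%N.
Proof.
move=> PW; apply: (big_ind3 (fun P w k => wdeg d P w k)) => //; first exact: wdeg_oneX.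
by move=> ? ? ? ? ? ?; exact: wdeg_mul.
Qed.

(** The condition d <= ord a as a boolean, to be summed as the X-degree 0 or 1 of an initial
    form. *)
Definition small_below d a := `[< forall s, s < d -> a s = 0 >].

(* min(d, ord a) *)
Definition ord_trunc d a : rat :=
  if small_below d a then d else xget 0 [set q | is_lead a q].

Lemma ord_trunc_lead N d a : (0 < N)%N -> in_lattice N a -> ~~ small_below d a ->
  is_lead a (ord_trunc d a) /\ ord_trunc d a < d.
Proof.
move=> N0 aN nS; have : ~ (forall s, s < d -> a s = 0) by move/asboolPn: nS.
move=> /existsNP [s /not_implyP [sd /eqP as0]].
have [e ae] := lead_exists N0 aN as0.
have -> : ord_trunc d a = e.
  by rewrite /ord_trunc (negPf nS); apply: xget_unique => // t /is_lead_uniq; exact.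
split=> //; apply: le_lt_trans sd; rewrite leNgt; apply/negP => /ae.2 /eqP.
by rewrite (negPf as0).
Qed.

Lemma small_below_eq d a b : (forall s, s < d -> a s = b s) ->
  small_below d a = small_below d b.
Proof.
by move=> ab; apply: asbool_equiv_eq; split=> H s sd; [rewrite -ab|rewrite ab]; auto.
Qed.

Lemma ord_trunc_eq N d a b : (0 < N)%N -> in_lattice N a -> in_lattice N b ->
  (forall s, s < d -> a s = b s) -> ord_trunc d a = ord_trunc d b.
Proof.
move=> N0 aN bN ab; have e := small_below_eq ab.
have [S|nS] := boolP (small_below d a); first by rewrite /ord_trunc -e S.
have nS' : ~~ small_below d b by rewrite -e.
have [A Ad] := ord_trunc_lead N0 aN nS; have [B Bd] := ord_trunc_lead N0 bN nS'.
apply: is_lead_uniq B; split; first by rewrite -ab// A.1.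
by move=> s sm; rewrite -ab ?A.2//; exact: lt_trans sm Ad.
Qed.

(** If ord a < d, the initial form is the leading term of -a. Otherwise it contains X, even in the
    tie ord a = d, because the highest X-degree is recorded. *)
Lemma wdeg_XsubF N d a : (0 < N)%N -> in_lattice N a ->
  wdeg d (XsubF a) (ord_trunc d a) (small_below d a).
Proof.
move=> N0 aN; have [S|nS] := boolP (small_below d a).
  have S' : forall s, s < d -> a s = 0 by apply/asboolP.
  rewrite /ord_trunc S; split; first by rewrite /= mul1r subrr /fone eqxx oner_neq0.
  move=> [|[|i]] s /=; last by rewrite eqxx.
    rewrite fctE oppr_eq0 mul0r addr0 => as0; have : d <= s.
      by rewrite leNgt; apply/negP => /S' /eqP; rewrite (negPf as0).
    by rewrite le_eqVlt => /orP[/eqP ->|]; [right|left].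
  rewrite /fone; have [-> _|] := eqVneq s 0; last by rewrite eqxx.
  by right; rewrite mul1r add0r.
have [[A0 Am] Ad] := ord_trunc_lead N0 aN nS.
split; first by rewrite /= mul0r subr0 fctE oppr_eq0.
move=> [|[|i]] s /=; last by rewrite eqxx.
  rewrite fctE oppr_eq0 mul0r addr0 => as0; have : ord_trunc d a <= s.
    by rewrite leNgt; apply/negP => /Am /eqP; rewrite (negPf as0).
  by rewrite le_eqVlt => /orP[/eqP ->|]; [right|left].
rewrite /fone; have [-> _|] := eqVneq s 0; last by rewrite eqxx.
by left; rewrite mul1r add0r.
Qed.

Lemma recenter00 (g : bivar R) a N : (0 < N)%N -> tame N a -> recenter g a 0%N 0 = g 0%N 0%N.
Proof.
move=> N0 aN; rewrite (recenter_nat2 (m := 1) (n := 1) _ N0 aN) ?addr0//.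
by rewrite !big_ord1 /= subr0 /fexp /= /fone eqxx mulr1 bin0.
Qed.

Lemma wdeg_unit d (v : bivar R) a N : (0 < N)%N -> tame N a -> 0 < d ->
  v 0%N 0%N != 0 -> wdeg d (recenter v a) 0 0.
Proof.
move=> N0 aN d0 v0; split; first by rewrite mul0r subr0 (recenter00 _ N0 aN).
move=> i s /(recenter_lattice N0 aN) [n ->].
case: i => [|i]; last first.
  left; have : 0 <= (n%:R / N%:R : rat) by rewrite divr_ge0.
  have : 0 < i.+1%:R * d by rewrite mulr_gt0.
  lra.
rewrite mul0r addr0; case: n => [|n]; first by right; rewrite mul0r.
by left; rewrite divr_gt0// ltr0n.
Qed.

Lemma wdeg_factor N d (g v : bivar R) n (r : 'I_n -> fracser R) a :
  (0 < N)%N -> tame N a -> (forall i, tame N (r i)) -> 0 < d -> v 0%N 0%N != 0 ->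
  factors_as g v r ->
  wdeg d (recenter g a) (\sum_(i < n) ord_trunc d (r i - a))
    (\sum_(i < n) small_below d (r i - a)%R)%N.
Proof.
move=> N0 aN rN d0 v0 hfac; rewrite (recenter_factor N0 aN rN hfac).
rewrite -[X in wdeg _ _ X]add0r -[X in wdeg _ _ _ X]add0n; apply: wdeg_mul.
  exact: wdeg_unit aN d0 v0.
apply: wdeg_big => i; apply: (wdeg_XsubF _ N0); apply: in_latticeD; first by case: (rN i).
by apply: in_latticeN; case: aN.
Qed.

End WeightedDegree.

(** * Conjugate series *)

Section Conjugation.
Variable R : realType.
Implicit Types (a b : fracser R) (q s : rat) (z : int).

(* exp(2 pi i z q), a character of the additive group of rat trivial on the
   integers; it extends q |-> zeta^(qN) for a root of unity zeta of order N. *)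
Definition chi z q : R[i] :=
  (cos (pi *+ 2 * z%:~R * ratr q) +i* sin (pi *+ 2 * z%:~R * ratr q))%C.

Lemma chiD z q s : chi z (q + s) = chi z q * chi z s.
Proof.
rewrite /chi rmorphD /= mulrDr cosD sinD; apply/eqP; rewrite eq_complex /= eqxx /=.
by rewrite addrC.
Qed.

Lemma chiDl z z' q : chi (z + z') q = chi z q * chi z' q.
Proof.
rewrite /chi rmorphD /= mulrDr mulrDl cosD sinD; apply/eqP; rewrite eq_complex /= eqxx /=.
by rewrite addrC.
Qed.

Lemma chi0 z : chi z 0 = 1.
Proof. by rewrite /chi rmorph0 mulr0 cos0 sin0. Qed.

Lemma chi_one z : chi z 1 = 1.
Proof.
have chi1 (n : nat) : chi n 1 = 1.
  rewrite /chi rmorph1 mulr1 -[pi *+ 2 * _]add0r -[_ * n%:~R]/(_ * n%:R) mulr_natr.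
  by rewrite (periodicn (@cosD2pi R)) (periodicn (@sinD2pi R)) cos0 sin0.
case: z => n //; have := chiDl n.+1 (Negz n) 1.
by rewrite NegzE subrr chi1 mul1r => <-; rewrite /chi mulr0 mul0r cos0 sin0.
Qed.

Lemma chi_mulrn z q (n : nat) : chi z (n%:R * q) = chi z q ^+ n.
Proof.
elim: n => [|n IH]; first by rewrite mul0r chi0.
by rewrite -natr1 mulrDl mul1r chiD IH exprSr.
Qed.

Lemma chi_nat z (n : nat) : chi z n%:R = 1.
Proof. by rewrite -[n%:R]mulr1 chi_mulrn chi_one expr1n. Qed.

Lemma chi_natl (n : nat) q : chi n q = chi 1 q ^+ n.
Proof.
elim: n => [|n IH]; first by rewrite /chi mulr0 mul0r cos0 sin0.
by rewrite exprSr -IH -chiDl -PoszD addn1.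
Qed.

Lemma chiNK z q : chi (- z) q * chi z q = 1.
Proof. by rewrite -chiDl addNr /chi mulr0 mul0r cos0 sin0. Qed.

Lemma chi_neq0 z q : chi z q != 0.
Proof. by apply/eqP => e; have /eqP := chiNK z q; rewrite e mulr0 eq_sym oner_eq0. Qed.

Lemma chi_prim (M : nat) : (0 < M)%N -> M.-primitive_root (chi 1 M%:R^-1).
Proof.
move=> M0; have M0' : M%:R != 0 :> rat by rewrite pnatr_eq0 -lt0n.
apply/andP; split=> //; apply/forallP => -[i /= iM]; apply/eqP.
rewrite unity_rootE -chi_mulrn.
have [->|ne] := eqVneq i.+1 M; first by rewrite mulfV// chi_one eqxx.
have {ne iM} iM : (i.+1 < M)%N by lia.
apply/negbTE/eqP => /eqP; rewrite eq_complex /= => /andP[/eqP c1 _]; move: c1.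
(* Half the angle: cos (2y) = 1 gives |cos y| = 1, hence sin y = 0, which is impossible for 0 < y <
   pi. *)
set y : R := pi * ratr (i.+1%:R / M%:R).
have -> : pi *+ 2 * 1%:~R * ratr (i.+1%:R / M%:R) = y *+ 2 by rewrite mulr1 -mulrnAl.
have y0 : 0 < y by rewrite mulr_gt0 ?pi_gt0// ltr0q divr_gt0 ?ltr0n.
have ypi : y < pi.
  rewrite -[ltRHS]mulr1 ltr_pM2l ?pi_gt0// -(rmorph1 (@ratr R)) ltr_rat ltr_pdivrMr ?ltr0n//.
  by rewrite mul1r ltr_nat.
rewrite cos_mulr2n => c2; have c1 : `|cos y| = 1.
  by apply/eqP; rewrite -(@eqrXn2 _ 2)// expr1n real_normK ?num_real//; apply/eqP; lra.
have := cos1sin0 c1; have := sin_gt0_pi (x := y); rewrite y0 ypi => /(_ isT) + e.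
by rewrite e ltxx.
Qed.

Lemma unity_root_chi (M : nat) (w : R[i]) : (0 < M)%N -> w ^+ M = 1 ->
  exists2 n : 'I_M, w = chi (n : nat) M%:R^-1 & True.
Proof.
move=> M0 wM; have [i ->] := prim_rootP (chi_prim M0) wM.
by exists i => //; rewrite chi_natl.
Qed.

(* y^(1/N) |-> zeta y^(1/N), for all N at once. *)
Definition conj_ser z a : fracser R := fun q => chi z q * a q.

Lemma conj_ser_eq0 z a q : (conj_ser z a q == 0) = (a q == 0).
Proof. by rewrite /conj_ser mulf_eq0 (negPf (chi_neq0 _ _)). Qed.

Lemma conj_serK z a : conj_ser (- z) (conj_ser z a) = a.
Proof. by apply/funext => q; rewrite /conj_ser mulrA chiNK mul1r. Qed.

Lemma conj_serB z a b : conj_ser z (a - b) = conj_ser z a - conj_ser z b.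
Proof. by apply/funext => q; rewrite /conj_ser !fctE mulrBr. Qed.

Lemma conj_ser_tame z N a : tame N a -> tame N (conj_ser z a).
Proof. by move=> [aN a1]; split=> q; rewrite conj_ser_eq0; [exact: aN|exact: a1]. Qed.

Lemma conj_ser_lead z a q : is_lead (conj_ser z a) q <-> is_lead a q.
Proof.
split=> -[A B]; split.
- by move: A; rewrite conj_ser_eq0.
- by move=> s /B /eqP; rewrite conj_ser_eq0 => /eqP.
- by rewrite conj_ser_eq0.
- by move=> s /B e; apply/eqP; rewrite conj_ser_eq0 e.
Qed.

Lemma conj_ser_fmul z a b : fmul (conj_ser z a) (conj_ser z b) = conj_ser z (fmul a b).
Proof.
apply/funext => q; rewrite /conj_ser /fmul mulr_fsumr; apply: eq_fsbigr => s _.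
by rewrite mulrACA -chiD addrC subrK.
Qed.

Lemma conj_ser_fexp z a n : fexp (conj_ser z a) n = conj_ser z (fexp a n).
Proof.
elim: n => [|n IH] /=; last by rewrite IH conj_ser_fmul.
apply/funext => q; rewrite /conj_ser /fexp /= /fone.
by have [->|] := eqVneq q 0; rewrite ?chi0 ?mul1r ?mulr0.
Qed.

(** The character is trivial on the integers, so conjugation fixes the powers of y that occur in
    g. *)
Lemma conj_ser_recenter z (g : bivar R) a k :
  recenter g (conj_ser z a) k = conj_ser z (recenter g a k).
Proof.
apply/funext => q; rewrite /conj_ser /recenter mulr_fsumr; apply: eq_fsbigr => -[i l] _ /=.
have -> : chi z q = chi z (q - l%:R) by have := chiD z (q - l%:R) l%:R; rewrite subrK chi_nat mulr1.
by rewrite conj_ser_fexp /conj_ser mulrnAr mulrCA.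
Qed.

Lemma wdeg_conj d (P : fracserX R) w k z : wdeg d P w k ->
  wdeg d (fun i => conj_ser z (P i)) w k.
Proof.
move=> [A B]; split=> [|i s]; first by rewrite conj_ser_eq0.
by rewrite conj_ser_eq0; exact: B.
Qed.

End Conjugation.

(** * The gradient degree *)

Section Monomial.
Variable R : realType.
Implicit Types (a b : fracser R) (q s : rat).

Lemma fmul_mono a u q s : fmul a (fmono u q) s = a (s - q) * u.
Proof.
rewrite /fmul (fsum_pt (i0 := s - q)); first by rewrite /fmono subKr eqxx.
move=> t tsq; rewrite /fmono; case: eqP => [e|_]; last by rewrite mulr0.
by move: tsq; rewrite -e subKr eqxx.
Qed.

Lemma fmono_fexp (u : R[i]) q n : fexp (fmono u q) n = fmono (u ^+ n) (n%:R * q).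
Proof.
elim: n => [|n IH]; first by apply/funext => s; rewrite mul0r /fmono /fexp /= /fone; case: eqP.
apply/funext => s; rewrite /fexp /= -/(fexp _ _) IH fmul_mono /fmono.
rewrite subr_eq -[n.+1%:R]natr1 mulrDl mul1r [q + _]addrC exprS.
by case: eqP => _; rewrite ?mul0r.
Qed.

Lemma fmono_tame N (n : nat) (u : R[i]) : 1 <= (n%:R / N%:R : rat) ->
  tame N (fmono u (n%:R / N%:R)).
Proof.
move=> q1; split=> q; rewrite /fmono.
  by have [-> _|] := eqVneq q (n%:R / N%:R); [exists n|rewrite eqxx].
by have [->|] := eqVneq q (n%:R / N%:R); last rewrite eqxx.
Qed.

Lemma along_mono N (n : nat) (g : bivar R) a (u : R[i]) s L : (0 < N)%N -> tame N a ->
  1 <= (n%:R / N%:R : rat) -> s < L%:R ->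
  along g (a + fmono u (n%:R / N%:R)) s =
  \sum_(k < L) recenter g a k (s - k%:R * (n%:R / N%:R)) * u ^+ k.
Proof.
move=> N0 aN q1 sL; rewrite (along_taylor _ N0 aN (fmono_tame u q1) sL).
by apply: eq_bigr => k _; rewrite fmono_fexp fmul_mono.
Qed.

Lemma nonroot_avoiding (B : set R[i]) (Q : {poly R[i]}) : finite_set B -> Q != 0 ->
  exists u, ~ B u /\ Q.[u] != 0.
Proof.
move=> /finite_seqP [X BX] Q0; pose Q' := Q * \prod_(b <- X) ('X - b%:P).
have Q'0 : Q' != 0 by rewrite mulf_neq0// monic_neq0// monic_prod_XsubC.
have [u uQ] : exists u : R[i], Q'.[u] != 0.
  apply: contrapT => H.
  pose rs : seq R[i] := [seq n%:R | n <- iota 0 (size Q')].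
  have : (size rs < size Q')%N.
    apply: max_poly_roots => //.
      by apply/allP => x _; rewrite /root; apply/negPn/negP => ?; apply: H; exists x.
    by rewrite map_inj_uniq ?iota_uniq// => i j /eqP; rewrite eqr_nat => /eqP.
  by rewrite size_map size_iota ltnn.
exists u; move: uQ; rewrite hornerM mulf_eq0 negb_or => /andP[-> uX]; split=> //.
rewrite BX /= => uX'; move/negP: uX; apply; rewrite -/(root _ _) root_prod_XsubC.
exact: uX'.
Qed.

End Monomial.

Section Height.
Variable R : realType.
Implicit Types (a b c gamma : fracser R) (d q s w h : rat) (f : bivar R).

Lemma along0 N f a : (0 < N)%N -> tame N a -> along f a 0 = f 0%N 0%N.
Proof. exact: recenter00. Qed.

Lemma recenter_dx_neq0 N f a k q : (0 < N)%N -> tame N a ->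
  recenter f a k.+1 q != 0 -> recenter (dx f) a k q != 0.
Proof.
by move=> N0 aN H; rewrite -(recenter_dx _ _ _ N0 aN) mulrn_eq0 negb_or.
Qed.

(** If f_x vanishes along c up to order h - 1, then y c' f_x vanishes up to order h, and the chain
    rule leaves h times the leading coefficient of f as that of f_y, at h - 1. This coefficient is
    nonzero because h is. *)
Lemma grad_ord_along N f c h : (0 < N)%N -> tame N c -> h != 0 ->
  is_lead (along f c) h -> (forall s, s <= h - 1 -> along (dx f) c s = 0) ->
  grad_ord f c = (h - 1)%:E.
Proof.
move=> N0 cN h0 [fh fs] fx0.
have fmul0 s : s <= h -> fmul (along (dx f) c) (yder c) s = 0.
  move=> sh; apply/eqP/negP => /negP /fmul_nz [t [ft]].
  rewrite /yder mulf_eq0 negb_or => /andP[_ /(cN.2) st].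
  by move/eqP: ft; apply; apply: fx0; lra.
have ydy : is_lead (along (dy f) c) (h - 1).
  split; first by rewrite (chain_rule _ _ N0 cN) fmul0// subr0 mulf_neq0// fmorph_eq0.
  move=> s sh; rewrite -(addrK 1 s) (chain_rule _ _ N0 cN).
  by rewrite fs ?fmul0 ?mulr0 ?subrr//; lra.
rewrite /grad_ord (ord_lead ydy); apply: min_r.
have cX : in_lattice N (along (dx f) c) by exact: recenter_lattice.
by apply/(ord_ge _ N0 cX) => s /ltW; exact: fx0.
Qed.

Lemma height_wdeg N f gamma d w k : (0 < N)%N -> tame N gamma -> f 0%N 0%N = 0 ->
  polar_arc f gamma -> gradient_degree f gamma d -> 1 < d ->
  wdeg d (recenter (dx f) gamma) w k -> is_lead (along f gamma) (w + 1).
Proof.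
move=> N0 gN f00 [_ fx0 fn0] [d0 dstab dmin] d1 W.
have [q fq] : exists q, along f gamma q != 0.
  apply: contrapT => H; apply: fn0; apply/funext => q; apply/eqP/negP => /negP ?.
  by apply: H; exists q.
have gX : in_lattice N (along f gamma) by exact: recenter_lattice.
have [h fh] := lead_exists N0 gX fq.
have h0 : h != 0.
  by apply/eqP => e; move: fh.1; rewrite e (along0 _ N0 gN) f00 eqxx.
have gradE : grad_ord f gamma = (h - 1)%:E.
  by apply: (grad_ord_along N0 gN h0 fh) => s _; rewrite fx0.
suff -> : w = h - 1 by rewrite subrK.
apply/eqP; case: ltgtP => // [wh|hw]; exfalso.
- (* For generic u, the order of f_x along gamma + u y^d is w. *)
  have [D D0 [n dE]] := rat_lattice (ltW d0).
  have dE' : d = (n * N)%N%:R / (N * D)%N%:R.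
    by rewrite dE natrM [(N * D)%N]mulnC natrM -mulf_div divff ?mulr1// pnatr_eq0 -lt0n.
  have ND0 : (0 < N * D)%N by rewrite muln_gt0 N0.
  have gND := tameM D0 gN.
  have d1' : 1 <= ((n * N)%N%:R / (N * D)%N%:R : rat) by rewrite -dE' ltW.
  (* The initial form of f_x at y = 1. The coefficient of y^w in f_x along gamma + u y^d is its
     value at u, and its coefficient of degree k is nonzero. *)
  pose Q := \poly_(i < k.+1) recenter (dx f) gamma i (w - i%:R * d).
  have Q0 : Q != 0.
    apply/eqP => /(congr1 (fun p : {poly R[i]} => p`_k)).
    by rewrite coef_poly ltnS leqnn coef0; apply/eqP; exact: W.1.
  have [u [nB Qu]] := nonroot_avoiding dstab Q0.
  apply: nB => /=; rewrite gradE.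
  set c := gamma + _.
  have cND : tame (N * D) c by rewrite /c dE'; apply: tameD => //; exact: fmono_tame.
  have fxw : along (dx f) c w != 0.
    set L := maxn k.+1 (Num.bound `|w|).
    have wL : w < L%:R.
      apply: (le_lt_trans (ler_norm _)); apply: (lt_le_trans (archi_boundP _)) => //.
      by rewrite ler_nat leq_maxr.
    rewrite /c [in X in _ + X]dE' (along_mono _ _ ND0 gND d1' wL) -dE'.
    suff -> : \sum_(i < L) recenter (dx f) gamma i (w - i%:R * d) * u ^+ i = Q.[u] by [].
    rewrite (horner_coef_le _ (L := L)); last first.
      by apply: leq_trans (size_poly _ _) _; rewrite leq_maxl.
    apply: eq_bigr => -[i /= iL] _; rewrite coef_poly; case: ltnP => // ki.
    have [->//|/W.2] := eqVneq (recenter (dx f) gamma i (w - i%:R * d)) 0.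
    by case=> [|[_ ik]]; [rewrite subrK ltxx|move: ki; rewrite ltnNge ik].
  move=> e; have : (grad_ord f c <= w%:E)%E.
    have cX : in_lattice (N * D) (along (dx f) c) by exact: recenter_lattice.
    by rewrite /grad_ord ge_min (ord_le_nz fxw ND0 cX).
  by rewrite -e lee_fin leNgt wh.
(* Some exponent below d is stable, by continuity of the weight in d. *)
set I0 := Num.bound `|h - 1|.
have hI0 : h - 1 < I0%:R.
  by apply: (le_lt_trans (ler_norm _)); exact: archi_boundP.
(* The first bound keeps the terms of X-degree at most I0 above weight h - 1; those of larger
   X-degree are above it as soon as q' > 1. The second bound ensures q' > 1. *)
pose e := Num.min ((w - (h - 1)) / I0.+1%:R) ((d - 1) / 2).
have e0 : 0 < e by rewrite lt_min divr_gt0 ?ltr0n ?subr_gt0//= divr_gt0// subr_gt0.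
have e1 : e * I0.+1%:R <= w - (h - 1) by rewrite -ler_pdivlMr ?ltr0n// ge_min lexx.
have e2 : e <= (d - 1) / 2 by rewrite ge_min lexx orbT.
set q' := d - e; have q1 : 1 < q' by rewrite /q'; lra.
have qd : q' < d by rewrite /q'; lra.
have q0 : 0 < q' by lra.
suff : grad_stable f gamma q' by move=> /(dmin _ q0); rewrite leNgt qd.
have qw i s : recenter (dx f) gamma i s != 0 -> h - 1 < s + i%:R * q'.
  move=> H; have := wdeg_ge W H => ws.
  have s0 : 0 <= s by have [j ->] := recenter_lattice N0 gN H; rewrite divr_ge0.
  have [iI|Ii] := leqP i I0.
    have : (i%:R : rat) * e <= I0%:R * e by rewrite ler_pM2r// ler_nat.
    by move: e1; rewrite -natr1 /q'; nra.
  have : (I0%:R : rat) <= i%:R by rewrite ler_nat ltnW.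
  have : (i%:R : rat) <= i%:R * q' by rewrite ler_peMr// ltW.
  lra.
(* No u at all is exceptional for q': the gradient keeps the order h - 1. *)
rewrite /grad_stable (_ : [set _ | _] = set0)//; apply/seteqP; split=> // u /= []; symmetry.
rewrite gradE.
have [D D0 [n qE]] := rat_lattice (ltW q0).
have qE' : q' = (n * N)%N%:R / (N * D)%N%:R.
  by rewrite qE natrM [(N * D)%N]mulnC natrM -mulf_div divff ?mulr1// pnatr_eq0 -lt0n.
have ND0 : (0 < N * D)%N by rewrite muln_gt0 N0.
have gND := tameM D0 gN.
have q1' : 1 <= ((n * N)%N%:R / (N * D)%N%:R : rat) by rewrite -qE' ltW.
set c := gamma + _.
have cND : tame (N * D) c by rewrite /c qE'; apply: tameD => //; exact: fmono_tame.
have sL s : s < (Num.bound `|s|).+1%:R.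
  apply: (le_lt_trans (ler_norm _)); apply: (lt_le_trans (archi_boundP _)) => //.
  by rewrite ler_nat.
apply: (grad_ord_along ND0 cND h0) => [|s sh]; last first.
  rewrite /c qE' (along_mono _ _ ND0 gND q1' (sL s)) -qE' big1// => i _.
  apply/eqP; rewrite mulf_eq0; apply/orP; left; apply/negPn/negP => /qw.
  by rewrite subrK; lra.
(* A term of X-degree i + 1 in f comes from one of X-degree i in f_x, which has weight above h - 1;
   the extra factor u y^q' lifts the exponent above h - 1 + q' > h. *)
have fc s : s <= h -> along f c s = along f gamma s.
  move=> sh; rewrite /c qE' (along_mono _ _ ND0 gND q1' (sL s)) -qE'.
  rewrite big_ord_recl /= mul0r subr0 mulr1 big1 ?addr0// => i _.
  apply/eqP; rewrite mulf_eq0; apply/orP; left; apply/negPn/negP.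
  move=> /(recenter_dx_neq0 N0 gN) /qw; rewrite /bump /= add1n -natr1 mulrDl mul1r.
  by rewrite opprD addrA addrAC subrK; lra.
split; first by rewrite fc// fh.1.
by move=> s sh; rewrite fc ?fh.2// ltW.
Qed.

(** Every term of f(gamma + delta) that involves delta has exponent at least w + d, which exceeds w
    + 1 because d > 1. *)
Lemma height_transfer N f gamma delta d w k : (0 < N)%N -> tame N gamma -> tame N delta ->
  1 < d -> (forall s, s < d -> delta s = 0) ->
  wdeg d (recenter (dx f) gamma) w k -> is_lead (along f gamma) (w + 1) ->
  is_lead (along f (gamma + delta)) (w + 1).
Proof.
move=> N0 gN dN d1 dd W.
have sL s : s < (Num.bound `|s|).+1%:R.
  apply: (le_lt_trans (ler_norm _)); apply: (lt_le_trans (archi_boundP _)) => //.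
  by rewrite ler_nat.
have dge s : delta s != 0 -> d <= s.
  by move=> ds; rewrite leNgt; apply/negP => /dd /eqP; rewrite (negPf ds).
have fc s : s <= w + 1 -> along f (gamma + delta) s = along f gamma s.
  move=> sw; rewrite (along_taylor _ N0 gN dN (sL s)) big_ord_recl /= big1 ?addr0.
    rewrite /fmul (fsum_pt (i0 := s)); first by rewrite subrr /fexp /= /fone eqxx mulr1.
    move=> t ts; rewrite /fexp /= /fone subr_eq0 eq_sym (negPf ts) mulr0//.
  move=> i _; apply/eqP/negP => /negP /fmul_nz [t [/(recenter_dx_neq0 N0 gN) /(wdeg_ge W) A B]].
  have {}B : fexp delta i.+1 (s - t) != 0 by [].
  by have := fexp_ge dge B; rewrite -natr1 mulrDl mul1r; lra.
move=> [A B]; split; first by rewrite fc.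
by move=> s sw; rewrite fc ?B// ltW.
Qed.

End Height.

(** * Branches and conjugate arcs *)

Lemma half_step (F : numFieldType) (C y z : F) :
  2 * C * z * (1 - 2^-1 * y) = 2 * C * z * (1 - y) + C * z * y.
Proof. by field. Qed.

(** * The identity theorem for power series *)

Section PowerSeries.
Variable R : realType.
Implicit Types (u : nat -> R[i]) (t : R[i]).

Definition psums u t : nat -> R[i]^o := series (fun m => u m * t ^+ m : R[i]^o).

(** Positive parameters tending to 0. Indexing them by integers lets the pigeonhole principle choose
    one root of unity for infinitely many of them. *)
Definition tau (l : nat) : R[i] := l.+1%:R^-1.

Lemma tau_gt0 l : 0 < tau l.
Proof. by rewrite invr_gt0 ltr0n. Qed.

Lemma tau_small (e : R[i]) : 0 < e -> exists l1, forall l, (l1 <= l)%N -> tau l < e.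
Proof.
move=> e0; have ei0 : 0 < e^-1 by rewrite invr_gt0.
have eR : (complex.Re e^-1)%:C%C = e^-1 by rewrite RRe_real// gtr0_real.
exists (Num.bound (complex.Re e^-1)) => l ll.
rewrite /tau -[e]invrK ltf_pV2 ?posrE ?ltr0n//.
rewrite -eR (_ : l.+1%:R = (l.+1%:R : R)%:C%C); last by rewrite rmorph_nat.
rewrite ltcR; apply: lt_le_trans (archi_boundP _) _; last by rewrite ler_nat; lia.
by move: ei0; rewrite -eR ltcR => /ltW.
Qed.

Lemma psums_nbhs u t (l : R[i]^o) (e : R[i]) : psums u t @ \oo --> l -> 0 < e ->
  exists n0, forall n, (n0 <= n)%N -> `|l - psums u t n| < e.
Proof.
move=> /cvgr_dist_lt /(_ e) H e0; have [n0 _ Hn] := H e0.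
by exists n0 => n nn; exact: Hn.
Qed.

Lemma psums_bounded u t (l : R[i]^o) : psums u t @ \oo --> l ->
  exists2 C : R[i], 0 < C & forall m, `|u m * t ^+ m| <= C.
Proof.
move=> ul; have [n0 Hn] := psums_nbhs ul ltr01.
pose D := \sum_(m < n0) `|u m * t ^+ m| + 2.
have D2 : 2 <= D by rewrite lerDr sumr_ge0.
exists D => [|m]; first by apply: lt_le_trans D2; rewrite ltr0n.
have [mn|nm] := ltnP m n0.
  rewrite /D (bigD1 (Ordinal mn))//= -addrA lerDl addr_ge0// sumr_ge0//.
apply: le_trans D2.
have -> : u m * t ^+ m = psums u t m.+1 - psums u t m.
  by rewrite /psums /series /= big_nat_recr//= addrAC subrr add0r.
have -> : psums u t m.+1 - psums u t m = (l - psums u t m) - (l - psums u t m.+1).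
  by rewrite opprB [RHS]addrC addrA subrK.
apply: le_trans (ler_normB _ _) _; apply: le_trans (lerD (ltW (Hn _ _)) (ltW (Hn _ _))) _; try by lia.
by [].
Qed.

(** Comparison with a geometric series of ratio x = |t| / rho <= 1/2: the partial sums past m0
    contribute at most 2 C x^(m0+1), and replacing the limit by a partial sum costs one more C
    x^(m0+1). *)
Lemma psums_tail u t (rho C : R[i]) (l : R[i]^o) m0 : 0 < rho -> 0 < C ->
  (forall m, `|u m| * rho ^+ m <= C) -> t != 0 -> `|t| <= rho / 2 ->
  (forall m, (m < m0)%N -> u m = 0) -> psums u t @ \oo --> l ->
  `|l - u m0 * t ^+ m0| <= 3 * C * (`|t| / rho) ^+ m0.+1.
Proof.
move=> r0 C0 uC t0 tr um ul; set x := `|t| / rho.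
have x0 : 0 < x by rewrite divr_gt0// normr_gt0.
have x2 : x <= 2^-1 by rewrite ler_pdivrMr// mulrC.
have term m : `|u m * t ^+ m| <= C * x ^+ m.
  rewrite normrM normrX expr_div_n mulrA ler_pdivlMr ?exprn_gt0//.
  by rewrite mulrAC ler_wpM2r// exprn_ge0.
have part n : `|psums u t (m0.+1 + n)%N - u m0 * t ^+ m0| <=
    2 * C * x ^+ m0.+1 * (1 - (2^-1) ^+ n).
  elim: n => [|n IH].
    rewrite addn0 subrr mulr0 /psums /series /= big_nat_recr//= big_nat_cond big1.
      by rewrite add0r subrr normr0.
    by move=> m /andP[/andP[_ mm] _]; rewrite um// mul0r.
  rewrite addnS /psums /series /= big_nat_recr//= addrAC.
  apply: le_trans (ler_normD _ _) _.
  have := lerD IH (term (m0.+1 + n)%N); move/le_trans; apply.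
  rewrite exprD mulrA.
  have -> : 2 * C * x ^+ m0.+1 * (1 - 2^-1 ^+ n.+1) =
     2 * C * x ^+ m0.+1 * (1 - 2^-1 ^+ n) + C * x ^+ m0.+1 * 2^-1 ^+ n.
    by rewrite (exprS 2^-1) half_step.
  rewrite lerD2l ler_wpM2l ?mulr_ge0 ?exprn_ge0 ?(ltW C0) ?(ltW x0)//.
  by apply: lerXn2r => //; rewrite nnegrE ?invr_ge0// ltW.
have e0 : 0 < C * x ^+ m0.+1 by rewrite mulr_gt0// exprn_gt0.
have [n0 Hn] := psums_nbhs ul e0.
have A := ltW (Hn (m0.+1 + n0)%N (leq_addl _ _)).
have B := part n0.
rewrite -(subrK (psums u t (m0.+1 + n0)%N) l) -addrA.
apply: le_trans (ler_normD _ _) _.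
have {}B : `|psums u t (m0.+1 + n0)%N - u m0 * t ^+ m0| <= 2 * C * x ^+ m0.+1.
  apply: le_trans B _; apply: ler_piMr; last by rewrite gerBl exprn_ge0// invr_ge0.
  by rewrite -mulrA mulr_ge0// ltW.
apply: le_trans (lerD A B) _.
by rewrite -[3]/(1 + 2 :> R[i]) !mulrDl mul1r.
Qed.

(** The lowest nonzero term would dominate the tail at small parameters. Zeros at infinitely many
    [tau l] suffice, which is all that the pigeonhole principle provides. *)
Lemma psums_eq0 u :
  (forall l1, exists2 l, (l1 <= l)%N & psums u (tau l) @ \oo --> (0 : R[i]^o)) ->
  forall m, u m = 0.
Proof.
move=> H; suff : ~ exists m, u m != 0.
  by move=> nu m; apply/eqP/negP => /negP ?; apply: nu; exists m.
move=> ex; case: (ex_minnP ex) => m0 um0 mmin.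
have um m : (m < m0)%N -> u m = 0.
  by move=> mm; apply/eqP/negP => /negP /mmin; lia.
have [l0 _ c0] := H 0%N; have r0 := tau_gt0 l0; set rho := tau l0 in c0 r0.
have [C C0 uC] := psums_bounded c0.
have uC' m : `|u m| * rho ^+ m <= C.
  by have := uC m; rewrite normrM normrX (gtr0_norm r0).
(* Below this threshold the tail bound 3 C (tau / rho)^(m0+1) is smaller than |u_m0| tau^m0. *)
have K0 : 0 < `|u m0| * rho ^+ m0.+1 / (3 * C).
  by rewrite divr_gt0 ?mulr_gt0 ?exprn_gt0 ?normr_gt0// ltr0n.
have [l1 L1] : exists l1, forall l, (l1 <= l)%N -> tau l < rho / 2.
  by apply: tau_small; rewrite divr_gt0// ltr0n.
have [l2 L2] := tau_small K0.
have [l ll cl] := H (maxn l1 l2); have t0 := tau_gt0 l.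
have tr : `|tau l| <= rho / 2.
  by rewrite gtr0_norm// ltW// L1//; lia.
have := psums_tail r0 C0 uC' (lt0r_neq0 t0) tr um cl.
rewrite sub0r normrN normrM normrX (gtr0_norm t0) expr_div_n mulrA.
rewrite ler_pdivlMr ?exprn_gt0// [tau l ^+ _.+1]exprSr mulrA mulrAC.
have := L2 l; rewrite (leq_trans (leq_maxr _ _) ll) => /(_ isT).
rewrite ltr_pdivlMr ?mulr_gt0 ?ltr0n// => A.
move: A; rewrite -(ltr_pM2r (exprn_gt0 m0 t0)) => A B.
have := lt_le_trans A B; rewrite (_ : tau l * (3 * C) * tau l ^+ m0 = 3 * C * tau l ^+ m0 * tau l).
  by rewrite ltxx.
by rewrite -mulrA mulrC.
Qed.

Lemma psumsB u u' t (l l' : R[i]^o) : psums u t @ \oo --> l -> psums u' t @ \oo --> l' ->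
  psums (fun m => u m - u' m) t @ \oo --> (l - l' : R[i]^o).
Proof.
move=> ul ul'; have -> : psums (fun m => u m - u' m) t = (fun n => psums u t n - psums u' t n).
  apply/funext => n; rewrite /psums /series /= -sumrB.
  by apply: eq_bigr => i _; rewrite mulrBl.
apply/cvgrPdist_lt => e e0; have e2 : 0 < e / 2 by rewrite divr_gt0// ltr0n.
have [n1 H1] := psums_nbhs ul e2; have [n2 H2] := psums_nbhs ul' e2.
exists (maxn n1 n2) => // n /= nn.
have -> : l - l' - (psums u t n - psums u' t n) = (l - psums u t n) - (l' - psums u' t n).
  by rewrite !opprB addrACA [RHS]addrACA [- psums u t n - _]addrC.
apply: le_lt_trans (ler_normB _ _) _; rewrite [ltRHS]splitr ltrD//.
- by apply: H1; lia.
- by apply: H2; lia.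
Qed.

Lemma cvg_subseq (v : nat -> R[i]^o) (phi : nat -> nat) (l : R[i]^o) :
  (forall k, exists n0, forall n, (n0 <= n)%N -> (k <= phi n)%N) ->
  v @ \oo --> l -> (v \o phi) @ \oo --> l.
Proof.
move=> phioo vl; apply: (@cvg_comp _ _ _ phi v \oo \oo) => // A [k _ kA].
by have [n0 Hn] := phioo k; exists n0 => // n nn /=; apply: kA; exact: Hn.
Qed.

End PowerSeries.

(** * Parametrizations of a curve germ *)

Section Curves.
Variable R : realType.
Implicit Types (a b : fracser R) (N M : nat) (t : R[i]) (z : int).

Lemma puiseux_sums_conj z a N t :
  puiseux_sums (conj_ser z a) N t = puiseux_sums a N (chi R z N%:R^-1 * t).
Proof.
apply/funext => n; rewrite /puiseux_sums /series /=; apply: eq_bigr => i _.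
by rewrite /conj_ser chi_mulrn exprMn mulrCA mulrA.
Qed.

Lemma is_denom_conj z a N : is_denom (conj_ser z a) N <-> is_denom a N.
Proof.
by split=> -[N0 H]; split=> // q aq; apply: H; move: aq; rewrite conj_ser_eq0.
Qed.

Lemma ramification_conj z a N : ramification (conj_ser z a) N <-> ramification a N.
Proof.
by split=> -[A B]; (split=> [|M AM]; first exact/(is_denom_conj z));
  apply: B; exact/(is_denom_conj z).
Qed.

Lemma chi_root z N : (0 < N)%N -> chi R z N%:R^-1 ^+ N = 1.
Proof. by move=> N0; rewrite -chi_mulrn mulfV ?chi_one// pnatr_eq0 -lt0n. Qed.

Lemma arc_image_conj z a : arc_image (conj_ser z a) = arc_image a.
Proof.
have sub z' a' : arc_image (conj_ser z' a') `<=` arc_image a'.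
  move=> w [N [t [/ramification_conj ram ct tw]]].
  exists N, (chi R z' N%:R^-1 * t); split=> //; first by rewrite -puiseux_sums_conj.
  by rewrite exprMn chi_root ?mul1r//; case: ram => -[].
apply/seteqP; split; first exact: sub.
by rewrite -{1}(conj_serK z a); exact: sub.
Qed.

Lemma curve_conj z a : curve (conj_ser z a) = curve a.
Proof. by rewrite /curve arc_image_conj. Qed.

Lemma arc_conj z a : is_arc a -> is_arc (conj_ser z a).
Proof.
move=> aa; have [N N0 aN] := arc_tame aa.
case: aa => -[N' [dN' [K aK] cN']] a1; split.
  exists N'; split; first exact/is_denom_conj.
    by exists K => q /aK e; apply/eqP; rewrite conj_ser_eq0 e.
  move: cN' => /nbhs_normP [e /= e0 eP]; apply/nbhs_normP.
  have c0 : 0 < `|chi R z N'%:R^-1| by rewrite normr_gt0 chi_neq0.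
  exists (e / `|chi R z N'%:R^-1|) => [|t /=]; first by rewrite /= divr_gt0.
  rewrite sub0r normrN ltr_pdivlMr// => te; rewrite puiseux_sums_conj; apply: eP.
  by rewrite /= sub0r normrN normrM mulrC.
have cN := conj_ser_tame z aN.
apply/(ord_ge _ N0 cN.1) => s s1; apply/eqP/negP => /negP /(cN.2).
by rewrite leNgt s1.
Qed.

(** Refining the denominator from N to N M inserts M - 1 zero terms after each term, so n refined
    terms contain n / M original ones, rounded up. *)
Lemma psums_coarse a N M t n : (0 < N)%N -> (0 < M)%N -> in_lattice N a ->
  psums (fun m => a (m%:R / (N * M)%N%:R)) t n =
  puiseux_sums a N (t ^+ M) ((n + M.-1) %/ M)%N.
Proof.
move=> N0 M0 aN; elim: n => [|n IH].
  by rewrite add0n divn_small ?prednK// /psums /puiseux_sums /series /= !big_geq.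
rewrite /psums /series /= big_nat_recr//= -[\sum_(0 <= _ < n) _]/(psums _ t n) IH.
have M0' : M%:R != 0 :> rat by rewrite pnatr_eq0 -lt0n.
have [/dvdnP [i nE]|nM] := boolP (M %| n)%N.
  rewrite nE addSnnS prednK// -mulSnr mulnK// divnMDl// divn_small ?prednK// addn0.
  rewrite /puiseux_sums /series /= big_nat_recr//=; congr (_ + _ * _).
    by rewrite !natrM -mulf_div divff// mulr1.
  by rewrite mulnC exprM.
suff a0 : a (n%:R / (N * M)%N%:R) = 0.
  rewrite a0 mul0r addr0.
  congr (puiseux_sums _ _ _ _).
  have nE := divn_eq n M; have rM : (n %% M < M)%N by rewrite ltn_mod.
  have r0 : (0 < n %% M)%N by rewrite lt0n -/(dvdn _ _).
  have -> : (n + M.-1 = (n %/ M).+1 * M + (n %% M).-1)%N by rewrite {1}nE mulSn; lia.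
  have -> : (n.+1 + M.-1 = (n %/ M).+1 * M + (n %% M))%N by rewrite {1}nE mulSn; lia.
  by rewrite !divnMDl// (divn_small rM) (divn_small (leq_ltn_trans (leq_pred _) rM)).
apply: contrapT => /eqP /aN [i0] /(congr1 (fun x => x * (N * M)%N%:R)).
rewrite mulfVK ?pnatr_eq0 ?muln_eq0 -?lt0n ?N0 ?M0//; last by lia.
rewrite natrM mulrA mulfVK ?pnatr_eq0 -?lt0n// -natrM => /eqP; rewrite eqr_nat => /eqP e.
by move/negP: nM; apply; rewrite e dvdn_mull.
Qed.

(** Each sequence of partial sums is the other one reindexed by a map tending to infinity. *)
Lemma psums_fine a N M t (l : R[i]^o) : (0 < N)%N -> (0 < M)%N -> in_lattice N a ->
  psums (fun m => a (m%:R / (N * M)%N%:R)) t @ \oo --> l <->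
  puiseux_sums a N (t ^+ M) @ \oo --> l.
Proof.
move=> N0 M0 aN; split=> H; last first.
  have -> : psums (fun m => a (m%:R / (N * M)%N%:R)) t =
      puiseux_sums a N (t ^+ M) \o (fun n => (n + M.-1) %/ M)%N.
    by apply/funext => n; exact: psums_coarse.
  apply: cvg_subseq H => k; exists (k * M)%N => n kn.
  by rewrite leq_divRL//; lia.
have -> : puiseux_sums a N (t ^+ M) =
    psums (fun m => a (m%:R / (N * M)%N%:R)) t \o (fun n => n * M)%N.
  apply/funext => n /=; rewrite psums_coarse// divnMDl// divn_small ?addn0//.
  by rewrite prednK.
by apply: cvg_subseq H => k; exists k => n kn; nia.
Qed.

Lemma arc_ramification a : is_arc a -> exists2 N, ramification a N & tame N a.
Proof.
move=> aa; have [N0 N00 aN0] := arc_tame aa.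
have ex : exists N, `[< is_denom a N >].
  by case: aa => -[N [dN _ _]] _; exists N; apply/asboolP.
case: (ex_minnP ex) => N /asboolP dN Nmin; exists N.
  by split=> // M dM; apply: Nmin; apply/asboolP.
split; last exact: aN0.2.
move=> q aq; have : q * N%:R \is a Num.nat.
  by rewrite natrEint dN.2//= mulr_ge0//; have := aN0.2 q aq; lra.
move=> /natrP [n qn]; exists n.
by rewrite -qn mulfK// pnatr_eq0 -lt0n; case: dN.
Qed.

Lemma ramification_uniq a N M : ramification a N -> ramification a M -> N = M.
Proof. by move=> [A B] [C D]; apply/eqP; rewrite eqn_leq B// D. Qed.

Lemma curve_eq a b : curve a = curve b ->
  \forall z \near ((0, 0) : R[i]^o * R[i]^o), arc_image a z <-> arc_image b z.
Proof.
move=> e; have : curve b (arc_image b) by exists (setT, setT); first by split; exact: filterT.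
by rewrite -e.
Qed.

Lemma tau_expn_near M (P : R[i] -> Prop) : (0 < M)%N ->
  (\forall t \near (0 : R[i]^o), P t) ->
  exists l1, forall l, (l1 <= l)%N -> P (tau R l ^+ M).
Proof.
move=> M0 /nbhs_normP [e /= e0 eP]; have [l1 L1] := tau_small e0.
exists l1 => l ll; apply: eP => /=; rewrite sub0r normrN normrX gtr0_norm ?tau_gt0//.
apply: le_lt_trans (L1 l ll); apply: ler_iXnr => //; first exact/ltW/tau_gt0.
by rewrite invf_le1 ?ltr0n// ler1n.
Qed.

Lemma denom_tame a N : is_denom a N -> (forall q, a q != 0 -> 1 <= q) -> tame N a.
Proof.
move=> [N0 dN] a1; split=> // q aq; have : q * N%:R \is a Num.nat.
  by rewrite natrEint dN//= mulr_ge0//; have := a1 q aq; lra.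
move=> /natrP [n qn]; exists n.
by rewrite -qn mulfK// pnatr_eq0 -lt0n.
Qed.

Lemma pigeonhole_cofinal n (P : 'I_n -> nat -> Prop) l1 :
  (forall l, (l1 <= l)%N -> exists i, P i l) ->
  exists i, forall l2, exists2 l, (l2 <= l)%N & P i l.
Proof.
move=> H; apply: contrapT => /forallNP nH.
have /choice [g Hg] : forall i, exists l2, forall l, (l2 <= l)%N -> ~ P i l.
  move=> i; have /existsNP [l2 Hl] := nH i; exists l2 => l ll Pil.
  by apply: Hl; exists l.
have [i Pi] := H (maxn l1 (\max_(i < n) g i)) (leq_maxl _ _).
by apply: (Hg i) Pi; rewrite leq_max (leq_bigmax i) orbT.
Qed.

Lemma nbhs00_tau (P : R[i]^o * R[i]^o -> Prop) (c : nat -> R[i]^o) (K : R[i]) L l0 :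
  (\forall z \near ((0, 0) : R[i]^o * R[i]^o), P z) -> (0 < L)%N -> 0 < K ->
  (forall l, (l0 <= l)%N -> `|c l| <= K * tau R l) ->
  exists l1, forall l, (l1 <= l)%N -> P (c l, tau R l ^+ L).
Proof.
move=> [[A B] [/= nA nB] AB] L0 K0 cK.
have [l1 L1] := tau_expn_near L0 nB.
move: nA => /nbhs_normP [e /= e0 eA].
have [l2 L2] : exists l2, forall l, (l2 <= l)%N -> tau R l < e / K.
  by apply: tau_small; rewrite divr_gt0.
exists (maxn l0 (maxn l1 l2)) => l ll; apply: AB; split=> /=; last by apply: L1; lia.
apply: eA => /=; rewrite sub0r normrN; apply: le_lt_trans (cK _ _) _; first by lia.
by rewrite mulrC -ltr_pdivlMr//; apply: L2; lia.
Qed.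

Lemma arc_coef0 N a : tame N a -> a 0 = 0.
Proof. by move=> [_ a1]; apply: contrapT => /eqP /a1; lra. Qed.

(* a and b parametrize the same branch, so for t = 1/(l+1) they take equal
   values up to a root of unity in the parameter of b; one root of unity serves
   infinitely many l, and the identity theorem applies. *)
Lemma curve_eq_conj a b : is_arc a -> is_arc b -> curve a = curve b ->
  exists z, a = conj_ser z b.
Proof.
move=> aa bb ab; have [N ramN aN] := arc_ramification aa.
have [M ramM bM] := arc_ramification bb.
have N0 : (0 < N)%N by case: ramN => -[].
have M0 : (0 < M)%N by case: ramM => -[].
have [N1 dN1 cN1] : exists2 N1, is_denom a N1 &
    \forall t \near (0 : R[i]^o), cvgn (puiseux_sums a N1 t).
  by case: aa => -[N1 [dN1 _ c]] _; exists N1.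
have N10 : (0 < N1)%N by case: dN1.
have aN1 := denom_tame dN1 aN.2.
(* Convergence is given for some denominator N1, while the images use the least ones N and M; y =
   t^L serves all three. *)
set L := (N * (M * N1))%N.
have L0 : (0 < L)%N by rewrite !muln_gt0 N0 M0.
have LE1 : L = (N1 * (N * M))%N by rewrite /L; lia.
have LEM : L = (M * (N * N1))%N by rewrite /L; lia.
set u := fun m : nat => a (m%:R / L%:R).
have NM0 : (0 < N * M)%N by rewrite muln_gt0 N0.
have [l0 Hl0] := tau_expn_near NM0 cN1.
pose c l := lim (puiseux_sums a N1 (tau R l ^+ (N * M)) @ \oo) : R[i]^o.
have uc l : (l0 <= l)%N -> psums u (tau R l) @ \oo --> c l.
  by move=> ll; rewrite /u LE1; apply/psums_fine => //; [case: aN1|exact: Hl0].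
have r0 := tau_gt0 R l0; have [C C0 uC] := psums_bounded (uc l0 (leqnn _)).
have uC' m : `|u m| * tau R l0 ^+ m <= C.
  by have := uC m; rewrite normrM normrX (gtr0_norm r0).
have [l1 L1] : exists l1, forall l, (l1 <= l)%N -> tau R l < tau R l0 / 2.
  by apply: tau_small; rewrite divr_gt0// ltr0n.
(* The tail bound at m0 = 0, where u vanishes: the points (c l, tau^L) tend to the origin, near
   which the two images agree. *)
have cK l : (maxn l0 l1 <= l)%N -> `|c l| <= 3 * C / tau R l0 * tau R l.
  move=> ll; have t0 := tau_gt0 R l.
  have tr : `|tau R l| <= tau R l0 / 2 by rewrite gtr0_norm// ltW// L1//; lia.
  have cl : psums u (tau R l) @ \oo --> c l by apply: uc; lia.
  have u0 : u 0%N = 0 by rewrite /u mul0r (arc_coef0 aN).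
  have nolt m : (m < 0)%N -> u m = 0 by [].
  have := psums_tail r0 C0 uC' (lt0r_neq0 t0) tr nolt cl.
  by rewrite u0 mul0r subr0 expr1 (gtr0_norm t0) mulrA mulrAC.
have [l2 Hl2] : exists l2, forall l, (l2 <= l)%N ->
    arc_image a (c l, tau R l ^+ L) <-> arc_image b (c l, tau R l ^+ L).
  apply: (nbhs00_tau (K := 3 * C / tau R l0) (curve_eq ab) L0 _ cK).
  by rewrite divr_gt0// mulr_gt0// ltr0n.
pose e (n : 'I_M) m := u m - conj_ser n b (m%:R / L%:R).
have ex l : (maxn l0 l2 <= l)%N ->
    exists n : 'I_M, psums (e n) (tau R l) @ \oo --> (0 : R[i]^o).
  move=> ll; have cl : psums u (tau R l) @ \oo --> c l by apply: uc; lia.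
  have : arc_image a (c l, tau R l ^+ L).
    exists N, (tau R l ^+ (M * N1)); split=> //=; last by rewrite -exprM mulnC.
    by apply/(psums_fine _ _ N0 _ aN.1) => //; rewrite muln_gt0 M0.
  move/(Hl2 l _).1; rewrite (leq_trans (leq_maxr _ _) ll) => /(_ isT).
  move=> [M' [s [/(ramification_uniq ramM) <- /= bs sM]]].
  have t0 : tau R l ^+ (N * N1) != 0 by rewrite expf_neq0// lt0r_neq0// tau_gt0.
  (* The point has second coordinate s^M = tau^L, and L = M (N N1), so s is tau^(N N1) up to an M-th
     root of unity. *)
  have wM : (s / tau R l ^+ (N * N1)) ^+ M = 1.
    by rewrite expr_div_n -sM LEM mulnC exprM divff// expf_neq0.
  have [n wn _] := unity_root_chi M0 wM.
  exists n; rewrite -(subrr (c l)); apply: psumsB => //.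
  rewrite LEM; apply/psums_fine => //.
  - by rewrite muln_gt0 N0.
  - by case: (conj_ser_tame n bM).
  - by rewrite puiseux_sums_conj -wn mulrC mulrA mulrC mulrA mulVf ?mul1r.
have [n Hn] := pigeonhole_cofinal ex.
exists n; apply/funext => q.
have en := psums_eq0 Hn.
have [[m ->]|qL] := pselect (exists m : nat, q = m%:R / L%:R).
  by apply/eqP; rewrite -subr_eq0; apply/eqP; exact: en.
have aL : in_lattice L a by apply: in_latticeM; [rewrite muln_gt0 M0|case: aN].
have bL : in_lattice L (conj_ser n b).
  by rewrite LEM; apply: in_latticeM; [rewrite muln_gt0 N0|case: (conj_ser_tame n bM)].
by rewrite (in_lattice_ext aL qL) (in_lattice_ext bL qL).
Qed.

End Curves.

(** * The top edge *)

Section HalfPlanes.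
Variable R : realType.
Local Notation plane := (R^o * R^o)%type.
Implicit Types (A : set plane) (a b c : R).

Definition half_plane a b c : set plane := [set z | c <= a * z.1 + b * z.2].

Lemma convE (x y : convex_lmodType plane) (t : {i01 R}) :
  conv t x y = t%:num *: (x : plane) + (1 - t%:num) *: (y : plane).
Proof. by []. Qed.

Lemma half_plane_convex a b c :
  convex_set (half_plane a b c : set (convex_lmodType plane)).
Proof.
move=> x y t; rewrite !inE /half_plane /= => cx cy.
have t0 : 0 <= t%:num by [].
have t1 : t%:num <= 1 by [].
have t1' : 0 <= 1 - t%:num by rewrite subr_ge0.
have := lerD (ler_wpM2l t0 cx) (ler_wpM2l t1' cy).
rewrite -mulrDl addrC subrK mul1r => /le_trans; apply.
rewrite le_eqVlt; apply/orP; left; apply/eqP; rewrite /unstable.onem /GRing.scale /=; ring.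
Qed.

Lemma half_plane_closed a b c : closed (half_plane a b c).
Proof.
have cf : continuous (fun z : plane => a * z.1 + b * z.2 : R^o).
  move=> z; apply: (@cvgD _ R^o); apply: (@cvgM R); try exact: cvg_cst.
    exact: cvg_fst.
  exact: cvg_snd.
apply: (@preimage_closed _ _ _ [set x : R^o | c <= x]).
  by move=> x _; exact: cf.
exact: closed_ge.
Qed.

Lemma conv_hull_sub A (H : set plane) :
  convex_set (H : set (convex_lmodType plane)) -> A `<=` H -> conv_hull A `<=` H.
Proof. by move=> cH AH; exact: smallest_sub. Qed.

Lemma sub_conv_hull A : A `<=` conv_hull A.
Proof. exact: sub_gen_smallest. Qed.

Lemma conv_hull_segment A (p q : plane) : conv_hull A p -> conv_hull A q ->
  segment p q `<=` conv_hull A.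
Proof.
move=> Ap Aq z [t [/andP[t0 t1] ->]] H [cH AH] /=.
have := cH q p (Itv01 t0 t1); rewrite !inE => /(_ (Aq _ (conj cH AH)) (Ap _ (conj cH AH))).
rewrite convE /=; congr (H _).
by rewrite scalerBl scale1r scalerBr [RHS]addrC addrAC addrA.
Qed.

Lemma boundary_sub_half_plane A a b c : A `<=` half_plane a b c ->
  boundary (conv_hull A) `<=` half_plane a b c.
Proof.
move=> AH z [cz _]; rewrite ((closure_id _).1 (@half_plane_closed a b c)).
apply: closureS cz; apply: conv_hull_sub => //; exact: half_plane_convex.
Qed.

(** Any step straight down from q leaves the half-plane, hence the hull, so q is not interior. *)
Lemma boundary_of_support A a c (q : plane) : A `<=` half_plane a 1 c -> A q ->
  a * q.1 + q.2 = c -> boundary (conv_hull A) q.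
Proof.
move=> AH Aq qc; split; first by apply: subset_closure; exact: sub_conv_hull.
move=> /nbhs_ballP [e /= e0 eA].
have : conv_hull A (q.1, q.2 - e / 2).
  apply: eA; split=> /=; first exact: ballxx.
  rewrite /ball /= opprB addrC subrK gtr0_norm; lra.
move=> /(conv_hull_sub (@half_plane_convex a 1 c) AH); rewrite /half_plane /=.
lra.
Qed.

(** The right end of each edge lies on or above the line of the other, which forces equal slopes.
    Hence [xget] in [top_edge] has only one choice. *)
Lemma lower_edge_uniq S (p : plane) E E' : lower_edge S p E -> lower_edge S p E' -> E = E'.
Proof.
move=> [q [s [pq Epq Ss SE]]] [q' [s' [pq' Epq' Ss' SE']]].
have mem (r p1 : plane) : segment r p1 p1 by exists 1; split; [lra|rewrite scale1r addrC subrK].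
have [Sq /= qs] : (S `&` [set z | z.2 = p.2 + s * (z.1 - p.1)]) q by rewrite SE Epq.
have [Sq' /= qs'] : (S `&` [set z | z.2 = p.2 + s' * (z.1 - p.1)]) q'.
  by rewrite SE' Epq'.
have A := Ss _ Sq'; have B := Ss' _ Sq.
have ss : s = s'.
  apply/le_anti/andP; split.
    by rewrite -(ler_pM2r (x := q'.1 - p.1)) ?subr_gt0//; move: A; rewrite qs' lerD2l.
  by rewrite -(ler_pM2r (x := q.1 - p.1)) ?subr_gt0//; move: B; rewrite qs lerD2l.
by rewrite -SE -SE' ss.
Qed.

Lemma len_x_segment (p q : plane) : p.1 <= q.1 -> len_x (segment p q) = q.1 - p.1.
Proof.
move=> pq; rewrite /len_x.
have -> : fst @` segment p q = `[p.1, q.1]%classic.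
  apply/seteqP; split=> [x [z [t [/andP[t0 t1] ->]] <-]|x] /=.
    by rewrite in_itv /= /GRing.scale /=; apply/andP; split; nra.
  rewrite in_itv /= => /andP[px xq].
  have [e|ne] := eqVneq p.1 q.1.
    exists p; last by apply: le_anti; rewrite px e xq.
    by exists 0; split; [rewrite lexx ler01|rewrite scale0r addr0].
  have d0 : 0 < q.1 - p.1 by rewrite subr_gt0 lt_neqAle ne.
  exists (p + ((x - p.1) / (q.1 - p.1)) *: (q - p)).
    exists ((x - p.1) / (q.1 - p.1)); split=> //.
    by rewrite divr_ge0 ?subr_ge0 ?(ltW d0)//= ler_pdivrMr// mul1r lerD2r.
  by rewrite /= /GRing.scale /= divfK ?gt_eqF// addrC subrK.
by rewrite sup_itv ?bnd_simp// inf_itv.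
Qed.

End HalfPlanes.

Section TopEdge.
Variable R : realType.
Local Notation plane := (R^o * R^o)%type.
Implicit Types (d w e : rat) (P : fracserX R).

(* The exponents of P lie in a lattice, so those on or above the supporting line
   of slope -d remain above a slightly less steep line through the right
   endpoint of the edge. *)
Lemma wdeg_gap N d P w k : (0 < N)%N -> (forall i, in_lattice N (P i)) -> 0 < d ->
  wdeg d P w k ->
  exists e, [/\ 0 < e, e < d &
    forall i s, P i s != 0 -> w - k%:R * e <= s + i%:R * (d - e)].
Proof.
move=> N0 PN d0 W; have [D D0 [n dE]] := rat_lattice (ltW d0).
have [j0 wE] := PN _ _ W.1.
set s0 := w - k%:R * d in wE; have wE' : w = s0 + k%:R * d by rewrite subrK.
have s00 : 0 <= s0 by rewrite wE divr_ge0.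
(* At X-degrees beyond k + I0, half of the slope d already compensates for s0, with no use of the
   lattice. *)
set I0 := (Num.bound (2 * s0 / d)).+1.
have hI0 : s0 <= I0%:R * (d / 2).
  have : 2 * s0 / d < I0%:R.
    apply: lt_le_trans (archi_boundP _) _; last by rewrite ler_nat.
    by rewrite divr_ge0 ?mulr_ge0// ltW.
  by rewrite ltr_pdivrMr//; lra.
have I00 : 0 < I0%:R :> rat by rewrite ltr0n.
have g0 : 0 < (N * D)%N%:R :> rat by rewrite ltr0n muln_gt0 N0.
(* The bound d / 2 treats the X-degrees beyond k + I0; the other one treats the I0 columns after k,
   where a point above the line exceeds it by at least 1 / (N D). *)
pose e := Num.min (d / 2) (((N * D)%N%:R)^-1 / I0%:R).
have e0 : 0 < e by rewrite lt_min !divr_gt0// invr_gt0.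
have ed : e <= d / 2 by rewrite ge_min lexx.
have eI : I0%:R * e <= ((N * D)%N%:R)^-1 by rewrite mulrC -ler_pdivlMr// ge_min lexx orbT.
exists e; split=> // [|i s Ps]; first by lra.
have [ik|ki] := leqP i k.
  have := wdeg_ge W Ps; have : (i%:R : rat) * e <= k%:R * e by rewrite ler_pM2r// ler_nat.
  by rewrite mulrBr; lra.
have ws : w < s + i%:R * d by case: (W.2 _ _ Ps) => // -[_]; rewrite leqNgt ki.
have [j sE] := PN _ _ Ps.
have iE : (i%:R : rat) = k%:R + (i - k)%N%:R by rewrite -natrD subnKC// ltnW.
have [iI|Ii] := leqP (i - k) I0.
  suff : ((N * D)%N%:R)^-1 <= s + i%:R * d - w.
    have : ((i - k)%N%:R : rat) * e <= I0%:R * e by rewrite ler_pM2r// ler_nat.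
    by rewrite mulrBr iE; lra.
  rewrite -[_^-1]mul1r ler_pdivrMr//.
  (* The excess over the supporting line is an integer multiple of 1 / (N D); being positive, it is
     at least 1 / (N D). *)
  have Z : (s + i%:R * d - w) * (N * D)%N%:R =
      ((j * D)%N%:Z + ((i - k) * n * N)%N%:Z - (j0 * D)%N%:Z)%:~R.
    rewrite rmorphB rmorphD /= -!pmulrn wE' sE wE iE dE !natrM.
    by field; rewrite !pnatr_eq0 -!lt0n N0 D0.
  have : 0 < (s + i%:R * d - w) * (N * D)%N%:R by rewrite mulr_gt0// subr_gt0.
  by rewrite Z ltr0z ler1z.
have s1 : 0 <= s by rewrite sE divr_ge0.
have : (I0%:R : rat) * (d / 2) <= (i - k)%N%:R * (d / 2) by rewrite ler_pM2r ?ler_nat ?divr_gt0// ltnW.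
have : ((i - k)%N%:R : rat) * e <= (i - k)%N%:R * (d / 2) by rewrite ler_wpM2l.
move: s1 => {Ps W PN sE ws}; rewrite wE' iE; move: ((i - k)%N%:R : rat) => m.
by move: hI0 => {e0 ed eI wE wE' s00 I00 g0}; clearbody e I0 s0; lra.
Qed.

(** Three half-planes contain the hull: the one of slope -d contains the edge in its border, X >= 0
    bounds it on the left, and the one of slope -(d - e), whose border meets that line at q, bounds
    it on the right. The empty column X = 0 forces k > 0, so the edge is not a point. *)
Lemma lower_edge_wdeg N d P w k : (0 < N)%N -> (forall i, in_lattice N (P i)) ->
  0 < d -> wdeg d P w k -> (forall s, P 0%N s = 0) ->
  lower_edge (conv_hull (newton_polygon P `|` [set (0, ratr w) : plane])) (0, ratr w)
    (segment ((0, ratr w) : plane) (k%:R, ratr (w - k%:R * d))).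
Proof.
move=> N0 PN d0 W P0; have [e [e0 ed gap]] := wdeg_gap N0 PN d0 W.
set p : plane := (0, ratr w); set q : plane := (k%:R, ratr (w - k%:R * d)).
set A := [set z : plane | exists i j (u v : R),
  [/\ P i j != 0, 0 <= u, 0 <= v & z = (i%:R + u, ratr j + v)]].
set S := conv_hull _.
have k0 : (0 < k)%N.
  by rewrite lt0n; apply/eqP => e'; have := W.1; rewrite e' P0 eqxx.
have above a c : 0 <= a -> (forall i s, P i s != 0 -> c <= s + i%:R * a) ->
    A `<=` half_plane (ratr a : R) 1 (ratr c).
  move=> a0 ac _ [i [j [u [v [Pij u0 v0 ->]]]]]; rewrite /half_plane /=.
  have : ratr c <= ratr (j + i%:R * a) :> R by rewrite ler_rat ac.
  rewrite rmorphD rmorphM /= ratr_nat.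
  have : 0 <= ratr a * u :> R by rewrite mulr_ge0// ler0q.
  by nra.
have AH : A `<=` half_plane (ratr d : R) 1 (ratr w).
  by apply: above => [|i s Ps]; [exact: ltW|exact: (wdeg_ge W)].
have AH' : A `<=` half_plane (ratr (d - e) : R) 1 (ratr (w - k%:R * e)).
  by apply: above => //; rewrite subr_ge0 ltW.
have A0 : A `<=` half_plane (1 : R) 0 0.
  by move=> _ [i [j [u [v [Pij u0 v0 ->]]]]]; rewrite /half_plane /= mul1r mul0r addr0 addr_ge0.
have SH a b c : A `<=` half_plane a b c -> half_plane a b c p -> S `<=` half_plane a b c.
  move=> AS Sp; apply: conv_hull_sub; first exact: half_plane_convex.
  by move=> z [|->//]; apply: (boundary_sub_half_plane AS).
have S1 : S `<=` half_plane (ratr d : R) 1 (ratr w).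
  by apply: SH => //; rewrite /half_plane /= mulr0 add0r mul1r.
have S2 : S `<=` half_plane (ratr (d - e) : R) 1 (ratr (w - k%:R * e)).
  apply: SH => //; rewrite /half_plane /= mulr0 add0r mul1r ler_rat gerBl.
  by rewrite mulr_ge0// ltW.
have S0 : S `<=` half_plane (1 : R) 0 0.
  by apply: SH => //; rewrite /half_plane /= mulr0 mul0r addr0.
have qE : ratr d * q.1 + q.2 = ratr w :> R.
  by rewrite /q /= rmorphB rmorphM /= ratr_nat; ring.
have Sp : S p by apply: sub_conv_hull; right.
have Sq : S q.
  apply: sub_conv_hull; left; apply: (boundary_of_support AH _ qE).
  exists k, (w - k%:R * d), 0, 0; split=> //; first exact: W.1.
  by rewrite !addr0.
exists q, (- ratr d); split=> //=.
- by rewrite ltr0n.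
- by move=> z /S1; rewrite /half_plane /=; lra.
apply/seteqP; split=> [z [Sz /= zE]|z pqz]; last first.
  split; first exact: (conv_hull_segment Sp Sq).
  by case: pqz => t [_ ->] /=; rewrite /GRing.scale /= rmorphB rmorphM /= ratr_nat; ring.
have := S2 _ Sz; have := S0 _ Sz; rewrite /half_plane /= => z0.
have e0' : 0 < ratr e :> R by rewrite ltr0q.
rewrite zE !rmorphB rmorphM /= ratr_nat => H.
have zk : z.1 <= k%:R.
  rewrite -(ler_pM2r e0'); move: H; lra.
have kR : 0 < k%:R :> R by rewrite ltr0n.
exists (z.1 / k%:R); split.
  by rewrite divr_ge0//=; [rewrite ler_pdivrMr// mul1r|lra].
apply: injective_projections; rewrite /= /GRing.scale /=.
  by rewrite subr0 divfK ?gt_eqF// add0r.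
by rewrite zE rmorphB rmorphM /= ratr_nat; field; rewrite gt_eqF.
Qed.

Lemma len_top_edge N (f : bivar R) a d w k : (0 < N)%N -> tame N a -> 0 < d ->
  along (dx f) a = 0 -> wdeg d (recenter (dx f) a) w k -> is_lead (along f a) (w + 1) ->
  len_x (top_edge f a) = k%:R.
Proof.
move=> N0 aN d0 fx0 W lead.
have vE : top_vertex f a = (0, ratr w) :> plane.
  by rewrite /top_vertex /height (ord_lead lead) /= rmorphD rmorph1 addrK.
have PN i : in_lattice N (recenter (dx f) a i) by exact: recenter_lattice.
have P0 s : recenter (dx f) a 0%N s = 0 by rewrite -/(along _ _) fx0.
have L := lower_edge_wdeg N0 PN d0 W P0.
rewrite /top_edge /aug_newton_polygon vE.
rewrite (xget_unique _ L) => [|E LE]; last exact: lower_edge_uniq LE L.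
by rewrite len_x_segment /= ?subr0.
Qed.

End TopEdge.

(** * Canyons and contact orders *)

Section Canyons.
Variable R : realType.
Implicit Types (a b gamma : fracser R) (d : rat).

Lemma common_tame n (r : 'I_n -> fracser R) : (forall i, is_arc (r i)) ->
  exists2 N, (0 < N)%N & forall i, tame N (r i).
Proof.
move=> rA; have /choice [D HD] : forall i, exists N, (0 < N)%N /\ tame N (r i).
  by move=> i; have [N N0 rN] := arc_tame (rA i); exists N.
exists (\prod_i D i)%N; first by rewrite prodn_gt0// => i; case: (HD i).
move=> i; rewrite (bigD1 i)//=; apply: tameM; last by case: (HD i).
by rewrite prodn_gt0// => j; case: (HD j).
Qed.

Lemma common_tame2 N N' a b : (0 < N)%N -> (0 < N')%N -> tame N a -> tame N' b ->
  tame (N * N') a /\ tame (N * N') b.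
Proof. by move=> N0 N'0 aN bN'; split; [exact: tameM|rewrite mulnC; exact: tameM]. Qed.

Lemma fmono_common_tame N a d : (0 < N)%N -> tame N a -> 1 <= d ->
  exists2 M, (0 < M)%N & forall u : R[i], tame (N * M) a /\ tame (N * M) (fmono u d).
Proof.
move=> N0 aN d1; have [M M0 [n dE]] := rat_lattice (le_trans ler01 d1).
exists M => // u; apply: common_tame2 => //.
by rewrite dE; apply: fmono_tame; rewrite -dE.
Qed.

Lemma canyon_mem gamma d a : is_arc gamma -> is_arc a -> 1 <= d ->
  (forall s, s < d -> a s = gamma s) -> canyon gamma d (curve a).
Proof.
move=> gA aA d1 ag; exists a, (a d - gamma d); split=> //.
have [N N0 gN] := arc_tame gA; have [N' N'0 aN'] := arc_tame aA.
have [gNN aNN] := common_tame2 N0 N'0 gN aN'.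
have NN0 : (0 < N * N')%N by rewrite muln_gt0 N0.
have [M M0 /(_ (a d - gamma d)) [gM uM]] := fmono_common_tame NN0 gNN d1.
have M1 : (0 < N * N' * M)%N by rewrite muln_gt0 NN0.
have lat := tameD (tameM M0 aNN) (tameN (tameD gM uM)).
apply/(ord_gt _ M1 lat.1) => s; rewrite !fctE /fmono le_eqVlt => /orP[/eqP ->|sd].
  by rewrite eqxx [gamma d + _]addrC subrK subrr.
by rewrite (lt_eqF sd) addr0 ag// subrr.
Qed.

(** Equality of curve germs is turned into conjugacy of arcs, so that membership in the canyon
    becomes a statement about coefficients. *)
Lemma canyon_repr gamma d a : is_arc gamma -> is_arc a -> 1 <= d ->
  canyon gamma d (curve a) ->
  exists z b, [/\ is_arc b, forall s, s < d -> b s = gamma s & a = conj_ser z b].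
Proof.
move=> gA aA d1 [b [u [bA bord /(curve_eq_conj aA bA) [z aE]]]].
exists z, b; split=> // s sd.
have [N N0 gN] := arc_tame gA; have [N' N'0 bN'] := arc_tame bA.
have [gNN bNN] := common_tame2 N0 N'0 gN bN'.
have NN0 : (0 < N * N')%N by rewrite muln_gt0 N0.
have [M M0 /(_ u) [gM uM]] := fmono_common_tame NN0 gNN d1.
have M1 : (0 < N * N' * M)%N by rewrite muln_gt0 NN0.
have lat := tameD (tameM M0 bNN) (tameN (tameD gM uM)).
move: bord => /(ord_gt _ M1 lat.1) /(_ s (ltW sd)).
by rewrite !fctE /fmono (lt_eqF sd) addr0 => /eqP; rewrite subr_eq0 => /eqP.
Qed.

End Canyons.

(** * Weight and contact number as functions of the centre *)

Section Contact.
Variable R : realType.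
Variables (f v : bivar R) (n : nat) (r : 'I_n -> fracser R) (d : rat).
Hypothesis rA : forall i, is_arc (r i).
Hypothesis hfac : factors_as (dx f) v r.
Hypothesis v0 : v 0%N 0%N != 0.
Hypothesis d0 : 0 < d.

Definition weight_at (a : fracser R) : rat := \sum_(i < n) ord_trunc d (r i - a).
Definition contact_at (a : fracser R) : nat := (\sum_(i < n) small_below d (r i - a)%R)%N.

Lemma wdeg_at a : is_arc a -> wdeg d (recenter (dx f) a) (weight_at a) (contact_at a).
Proof.
move=> /arc_tame [N N0 aN]; have [N' N'0 rN'] := common_tame rA.
apply: (wdeg_factor (N := N * N')) hfac => //.
- by rewrite muln_gt0 N0.
- exact: tameM.
- by move=> i; rewrite mulnC; exact: tameM.
Qed.

Lemma wdeg_at_eq a b : is_arc a -> is_arc b -> (forall s, s < d -> a s = b s) ->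
  weight_at a = weight_at b /\ contact_at a = contact_at b.
Proof.
move=> /arc_tame [N N0 aN] /arc_tame [N' N'0 bN'] ab.
have [aNN bNN] := common_tame2 N0 N'0 aN bN'; have [M M0 rM] := common_tame rA.
have NN0 : (0 < N * N')%N by rewrite muln_gt0 N0.
have M1 : (0 < N * N' * M)%N by rewrite muln_gt0 NN0.
have rNM i : tame (N * N' * M) (r i) by rewrite mulnC; exact: tameM.
have rab i s : s < d -> (r i - a) s = (r i - b) s by move=> sd; rewrite !fctE ab.
split; apply: eq_bigr => i _; last by rewrite (small_below_eq (rab i)).
apply: (ord_trunc_eq M1) (rab i).
- exact: (tameD (rNM i) (tameN (tameM M0 aNN))).1.
- exact: (tameD (rNM i) (tameN (tameM M0 bNN))).1.
Qed.

(** The roots r_i stay in place while a moves, so the two sums are not compared term by term.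
    Recentering is equivariant and conjugation preserves supports, which determine the weight and
    the degree. *)
Lemma wdeg_at_conj z a : is_arc a ->
  weight_at (conj_ser z a) = weight_at a /\ contact_at (conj_ser z a) = contact_at a.
Proof.
move=> aA; have W := wdeg_at (arc_conj z aA).
have W' := wdeg_conj z (wdeg_at aA).
apply: wdeg_uniq W _; rewrite (_ : recenter (dx f) _ = fun k => conj_ser z (recenter (dx f) a k))//.
by apply/funext => k; exact: conj_ser_recenter.
Qed.

Lemma mult_bar_contact gamma k : is_arc gamma -> 1 <= d ->
  canyon gamma d (curve (r k)) ->
  mult_bar r (canyon gamma d) d (r k) = contact_at gamma.
Proof.
move=> gA d1 Kk; have [z [b [bA bg rkE]]] := canyon_repr gA (rA k) d1 Kk.
have -> : contact_at gamma = contact_at (r k).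
  by rewrite rkE (wdeg_at_conj z bA).2 (wdeg_at_eq bA gA bg).2.
have [N N0 rN] := common_tame rA.
rewrite /mult_bar -sum1dep_card big_mkcond /=; apply: eq_bigr => i _.
have rN' := (tameD (rN i) (tameN (rN k))).1.
(* Closeness to [r k] already implies membership in the canyon: the conjugation that takes [r k]
   back to b takes [r i] to an arc equal to gamma below y^d, with the same curve. *)
suff -> : `[< canyon gamma d (curve (r i)) >] && (d%:E <= ord (r i - r k)%R)%E =
    small_below d (r i - r k) by case: small_below.
apply/andP/asboolP => [[_ /(ord_ge _ N0 rN')]//|S].
split; last exact/(ord_ge _ N0 rN').
apply/asboolP; rewrite -(curve_conj (- z)); apply: canyon_mem => //; first exact: arc_conj.
move=> s sd; rewrite -bg//; apply/eqP; rewrite -subr_eq0.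
have -> : b = conj_ser (- z) (r k) by rewrite rkE conj_serK.
rewrite -[_ - _]/((conj_ser (- z) (r i) - conj_ser (- z) (r k)) s) -conj_serB conj_ser_eq0.
by rewrite S.
Qed.

End Contact.

Theorem lemma5p3 (R : realType) (f : bivar R) (m : nat)
  (hf : holomorphic_germ f) (hreg : mini_regular f) (hm : order0 f m)
  (gamma0 : fracser R) (hgamma0 : polar_arc f gamma0)
  (d : rat) (hd : gradient_degree f gamma0 d) (hd1 : 1 < d)
  (K : set (plane_germ R)) (hK : K = canyon gamma0 d)
  (v : bivar R) (hv : holomorphic_unit v)
  (r : 'I_m.-1 -> fracser R) (hr : forall i, is_arc (r i))
  (hfac : factors_as (dx f) v r)
  (alpha : fracser R) (halpha : polar_arc f alpha) (halphaK : K (curve alpha))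
  (k : 'I_m.-1) (hk : K (curve (r k))) :
  len_x (top_edge f alpha) = (mult_bar r K d (r k))%:R.
Proof.
subst K; have d1 := ltW hd1; have d0 : 0 < d by exact: lt_trans hd1.
have [gA _ _] := hgamma0; have [aA fx0 _] := halpha; have v0 := hv.2.
rewrite (mult_bar_contact hr hfac v0 d0 gA d1 hk).
have [z [b [bA bg aE]]] := canyon_repr gA aA d1 halphaK.
have [N N0 gN] := arc_tame gA; have [N' N'0 bN'] := arc_tame bA.
have [gNN bNN] := common_tame2 N0 N'0 gN bN'.
have NN0 : (0 < N * N')%N by rewrite muln_gt0 N0.
have W := wdeg_at hr hfac v0 d0 gA.
have leadg := height_wdeg NN0 gNN hf.2 hgamma0 hd hd1 W.
have bgN := tameD bNN (tameN gNN).
(* The height is known at gamma0 only. It passes to b, which agrees with gamma0 below y^d, and then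
   to the conjugate alpha of b. *)
have leadb : is_lead (along f b) (weight_at r d gamma0 + 1).
  have -> : b = gamma0 + (b - gamma0) by rewrite addrC subrK.
  apply: (height_transfer NN0 gNN bgN hd1 _ W leadg) => s sd.
  by rewrite !fctE bg// subrr.
have leada : is_lead (along f alpha) (weight_at r d gamma0 + 1).
  by rewrite aE /along conj_ser_recenter; apply/conj_ser_lead.
have := wdeg_at hr hfac v0 d0 aA.
have [wE cE] := wdeg_at_conj hr hfac v0 d0 z bA.
have [wE' cE'] := wdeg_at_eq hr bA gA bg.
rewrite {2 3}aE wE cE wE' cE' => Wa.
have aN : tame (N * N') alpha by rewrite aE; exact: conj_ser_tame.
exact: len_top_edge NN0 aN d0 fx0 Wa leada.
Qed.
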